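(* Let $(X_k)_{k\ge 1}$ be a sequence of independent centered real random variables on a probability space with finite second order moments, and let $(p(n))_{n\ge1}$ be an arbitrary sequence of non-negative integers. Then the following two assertions are equivalent: (a) as $n\to+\infty$, $$\max_{p(n)+1\le k\le n+p(n)}\left(\frac{\sigma_k}{s_n'}\right)^2\longrightarrow 0\quad\text{and}\quad \frac{S_n'}{s_n'}\ \text{converges in distribution to}\ \mathcal N(0,1);$$ (b) for every $\varepsilon>0$, $$g_n(\varepsilon)=\frac{1}{(s_n')^{2}}\sum_{k=p(n)+1}^{n+p(n)}\int_{\{|x|\ge\varepsilon s_n'\}}x^2\,dF_k(x)\longrightarrow 0\quad\text{as } n\to+\infty .$$
   Context: Notation: $S_n'=\sum_{k=p(n)+1}^{n+p(n)}X_k$, $\sigma_k^2=\mathbb{E}(X_k^2)$ with $\sigma_k\ge 0$, $F_k(x)=\mathbb{P}(X_k\le x)$ is the distribution function of $X_k$, and $s_n'=\left(\sum_{k=p(n)+1}^{n+p(n)}\sigma_k^2\right)^{1/2}$, assumed positive so that the quotients make sense. $\mathcal N(0,1)$ is the standard normal law. *)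

(* Defs.v *)
From HB Require Import structures.
From mathcomp Require Import all_boot all_order all_algebra finmap.
From mathcomp Require Import all_classical all_reals all_analysis.
From mathcomp Require Import measurable_realfun.
Set Implicit Arguments.
Unset Strict Implicit.
Unset Printing Implicit Defensive.
Import Order.TTheory GRing.Theory Num.Theory.
Import numFieldNormedType.Exports.
Local Open Scope classical_set_scope.
Local Open Scope ring_scope.

(* Mutual independence of the variables [X i] with [i] in [D]. *)
Definition independent_RVs d d' (T : measurableType d) (T' : measurableType d')
    (R : realType) (P : probability T R) (I : choiceType) (D : set I)
    (X : I -> {RV P >-> T'}) : Prop :=
  forall J : {fset I}, [set` J] `<=` D ->
  forall A : I -> set T', (forall i, measurable (A i)) ->
  P (\bigcap_(i in [set` J]) (X i @^-1` A i)) =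
  (\prod_(i <- J) P (X i @^-1` A i))%E.

(* Weak convergence of the laws: convergence of the integrals of bounded
   continuous test functions.  [measurableTypeR R] is [R] with its Borel sets,
   under the display used by [normal_prob]. *)
Definition cvg_in_distribution d (T : measurableType d) (R : realType)
    (P : probability T R) (Y : nat -> {RV P >-> R})
    (mu : probability (measurableTypeR R) R) : Prop :=
  forall f : R -> R, continuous f -> (exists M : R, forall x, `|f x| <= M) ->
  ('E_P[f \o Y n] @[n --> \oo] --> \int[mu]_x (f x)%:E)%E.

Section distribution_function.
Context d (T : measurableType d) (R : realType) (P : probability T R).
Variable X : {RV P >-> R}.

(* The library's [cdf] takes its values in [\bar R], whereas
   [lebesgue_stieltjes_measure] expects a real-valued function. *)
Definition distr_fun (x : R) : R := fine (cdf X x).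

Let distr_fun_nd : nondecreasing distr_fun.
Proof.
by move=> x y xy; rewrite fine_le ?fin_num_measure// cdf_nondecreasing.
Qed.

Let distr_fun_rc : right_continuous distr_fun.
Proof.
move=> a; apply: fine_cvg.
by rewrite fineK ?fin_num_measure//; exact: cdf_right_continuous.
Qed.

HB.instance Definition _ :=
  isCumulative.Build R _ R distr_fun distr_fun_nd distr_fun_rc.

End distribution_function.

Section block_sums.
Context d (T : measurableType d) (R : realType) (P : probability T R).
Variables (X : nat -> {RV P >-> R}) (p : nat -> nat).

Definition sigma (k : nat) : R :=
  Num.sqrt (fine 'E_P[fun w => X k w ^+ 2]).

Definition s' (n : nat) : R :=
  Num.sqrt (\sum_((p n).+1 <= k < (n + p n).+1) sigma k ^+ 2).

Definition S' (n : nat) : {RV P >-> R} :=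
  \sum_((p n).+1 <= k < (n + p n).+1) (X k : {mfun T >-> R}).

Definition normalized_S' (n : nat) : {RV P >-> R} :=
  (s' n)^-1 *: (S' n : {mfun T >-> R}).

(* The terms are nonnegative, so starting the maximum at 0 is harmless. *)
Definition max_ratio (n : nat) : R :=
  \big[Num.max/0]_((p n).+1 <= k < (n + p n).+1) (sigma k / s' n) ^+ 2.

Definition g (n : nat) (eps : R) : \bar R :=
  (((s' n ^+ 2)^-1)%:E *
   \sum_((p n).+1 <= k < (n + p n).+1)
     \int[lebesgue_stieltjes_measure (distr_fun (X k))]_(x in
         [set x : R | (eps * s' n <= `|x|)%R]) (x ^+ 2)%:E)%E.

End block_sums.

(* Main.v *)
From HB Require Import structures.
Require Import Defs.
From mathcomp Require Import all_boot all_order all_algebra finmap.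
From mathcomp Require Import all_classical all_reals all_analysis.
From mathcomp Require Import measurable_realfun ring lra.
Import Order.TTheory GRing.Theory Num.Theory.
Import numFieldNormedType.Exports.
Local Open Scope classical_set_scope.
Local Open Scope ring_scope.
Set Implicit Arguments.
Unset Strict Implicit.

(** Everything is read off the characteristic functions of the summands, in
    real form: the mean of [cos (th + t * Y)] contains, through the phase [th],
    both the real and the imaginary part of the characteristic function of [Y]
    at [t].

    Lindeberg's condition implies the limit theorem.  Independence makes the
    characteristic function of the normalized sum a product.  The Taylor
    remainders of cosine and sine ([cos_remainder], [sin_remainder]) show that
    each factor is close to that of a centered normal variable of the same
    variance, the sum of the errors being controlled by the Lindeberg sum, so
    that the product is close to [expR (- (t ^+ 2 / 2))] ([lindeberg_bound]).
    This is the characteristic function of the normal law, by integration by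
    parts ([Rintegral_normal_cos]).  As the second moments are bounded, the laws
    are tight, and a bounded continuous function can be replaced by a
    trigonometric polynomial up to a small error in the mean
    ([trig_poly_approx], [cvg_Rintegral_bounded_continuous]).

    Conversely ([lindeberg_sum_le]), let [c k] be the real part of the
    characteristic function of the [k]-th normalized summand.  The squared
    modulus of the characteristic function of the sum is at least the product of
    the [c k ^+ 2]; it tends to [expR (- t ^+ 2)], and since the [c k] are
    uniformly close to 1 this forces the sum of the [1 - c k] to be
    asymptotically at least [t ^+ 2 / 2], the value of the sum of the quadratic
    terms [t ^+ 2 * variance / 2].  The means of the nonnegative functions
    [(t * x) ^+ 2 / 2 - 1 + cos (t * x)] thus have a sum tending to 0.  On the
    tail such a function dominates a multiple of the square, which makes the
    Lindeberg sum tend to 0 as soon as [t] is large enough. *)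

(** * Taylor remainders of cosine, sine and exponential *)

Section real_bounds.
Variable R : realType.
Implicit Types (x y t a c : R) (f g : R -> R).

Lemma ge0_of_derive_ge0 f g : f 0 = 0 ->
  (forall x, is_derive x 1 f (g x)) -> (forall x, 0 <= x -> 0 <= g x) ->
  forall x, 0 <= x -> 0 <= f x.
Proof.
move=> f0 df g0 x; rewrite le_eqVlt => /orP[/eqP <-|x0]; first by rewrite f0.
have cf : {within `[0, x], continuous f}.
  apply: derivable_within_continuous => y _; exact: ex_derive.
have [c /[!in_itv]/= /andP[c0 _]] := MVT x0 (fun y _ => df y) cf.
by rewrite f0 !subr0 => ->; rewrite mulr_ge0 ?g0// ltW.
Qed.

Lemma sin_le_id x : 0 <= x -> sin x <= x.
Proof.
move=> x0; rewrite -subr_ge0.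
apply: (@ge0_of_derive_ge0 (fun x => x - sin x) (fun x => 1 - cos x)) => //.
by rewrite sin0 subr0.
Qed.

Lemma cos_ge_sqr x : 1 - x ^+ 2 / 2 <= cos x.
Proof.
wlog x0 : x / 0 <= x.
  move=> H; have [x0|x0] := leP 0 x; first exact: H.
  by rewrite -cosN -sqrrN H// oppr_ge0 ltW.
rewrite -subr_ge0.
apply: (@ge0_of_derive_ge0 (fun x => cos x - (1 - x ^+ 2 / 2))
  (fun x => x - sin x)) => //.
- by rewrite cos0; ring.
- move=> y; apply: is_derive_eq.
  rewrite !scaler0 !scaler1 /GRing.scale /=; by field.
- by move=> y y0; rewrite subr_ge0 sin_le_id.
Qed.

Lemma sin_ge_cube x : 0 <= x -> x - x ^+ 3 / 6 <= sin x.
Proof.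
move=> x0; rewrite -subr_ge0.
apply: (@ge0_of_derive_ge0 (fun x => sin x - (x - x ^+ 3 / 6))
  (fun x => cos x - (1 - x ^+ 2 / 2))) => //.
- by rewrite sin0; ring.
- move=> y; apply: is_derive_eq.
  rewrite !scaler0 !scaler1 /GRing.scale /=; by field.
- by move=> y y0; rewrite subr_ge0 cos_ge_sqr.
Qed.

Lemma cos_le_quartic x : cos x <= 1 - x ^+ 2 / 2 + x ^+ 4 / 24.
Proof.
wlog x0 : x / 0 <= x.
  move=> H; have [x0|x0] := leP 0 x; first exact: H.
  have -> : x ^+ 4 = (- x) ^+ 4 by ring.
  by rewrite -cosN -sqrrN H// oppr_ge0 ltW.
rewrite -subr_ge0.
apply: (@ge0_of_derive_ge0 (fun x => 1 - x ^+ 2 / 2 + x ^+ 4 / 24 - cos x)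
  (fun x => sin x - (x - x ^+ 3 / 6))) => //.
- by rewrite cos0; field.
- move=> y; apply: is_derive_eq.
  rewrite !scaler0 !scaler1 /GRing.scale /=; by field.
- by move=> y y0; rewrite subr_ge0 sin_ge_cube.
Qed.

Lemma one_sub_cos_ge x : `|x| <= 1 -> x ^+ 2 / 3 <= 1 - cos x.
Proof.
move=> x1; have := cos_le_quartic x.
have : x ^+ 4 <= x ^+ 2.
  have -> : x ^+ 4 = x ^+ 2 * x ^+ 2 by ring.
  by rewrite ler_piMl ?sqr_ge0// -(@real_normK _ x) ?num_real// exprn_ile1.
by have := sqr_ge0 x; lra.
Qed.

Lemma cube_le t x e : `|x| <= e -> `|t * x| ^+ 3 <= `|t| ^+ 3 * e * x ^+ 2.
Proof.
move=> xe; rewrite normrM exprMn -mulrA ler_wpM2l ?exprn_ge0//.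
by rewrite -(@real_normK _ x) ?num_real// [leLHS]exprS ler_wpM2r ?exprn_ge0.
Qed.

(** The two Taylor remainders that govern characteristic functions are bounded
    by the square of the argument everywhere and by its cube near the origin;
    splitting at the threshold [e] is what makes Lindeberg's sums appear. *)
Lemma cos_remainder t x e : 0 < e ->
  `|cos (t * x) - (1 - t ^+ 2 * x ^+ 2 / 2)|
    <= `|t| ^+ 3 * e * x ^+ 2 + t ^+ 2 * (x ^+ 2 *+ (e <= `|x|)%R).
Proof.
move=> e0; have := cos_ge_sqr (t * x); have := cos_le_quartic (t * x).
rewrite ger0_norm; last first.
  by rewrite subr_ge0 -exprMn cos_ge_sqr.
set y := t * x; have -> : t ^+ 2 * x ^+ 2 = y ^+ 2 by rewrite exprMn.
move=> h1 h2.
have tx0 : 0 <= `|t| ^+ 3 * e * x ^+ 2 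
  by rewrite mulr_ge0 ?sqr_ge0// mulr_ge0 ?exprn_ge0// ltW.
have [ex|xe] := leP e `|x|; rewrite ?mulr1n ?mulr0n.
  apply: ler_wpDl => //; have -> : t ^+ 2 * x ^+ 2 = y ^+ 2 by rewrite exprMn.
  by have := cos_le1 y; have := sqr_ge0 y; lra.
rewrite mulr0 addr0.
have r3 : cos y - (1 - y ^+ 2 / 2) <= `|y| ^+ 3.
  have -> : y ^+ 2 = `|y| ^+ 2 by rewrite real_normK ?num_real.
  have h3 : cos y - (1 - `|y| ^+ 2 / 2) <= `|y| ^+ 4 / 24.
    have -> : `|y| ^+ 4 = y ^+ 4 by rewrite -normrX ger0_norm// exprn_even_ge0.
    by rewrite real_normK ?num_real//; lra.
  have := cos_le1 y; move: h3 (normr_ge0 y); set z := `|y| => h3 z0 c1.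
  have [z1|z1] := leP z 1.
    have : z ^+ 4 <= z ^+ 3 by rewrite exprS ler_piMl ?exprn_ge0.
    have : 0 <= z ^+ 3 by rewrite exprn_ge0.
    by lra.
  have : z ^+ 2 <= z ^+ 3 by rewrite ler_eXn2l.
  by have := sqr_ge0 z; lra.
by apply: (le_trans r3); apply: cube_le; rewrite ltW.
Qed.

Lemma sin_remainder t x e : 0 < e ->
  `|sin (t * x) - t * x|
    <= `|t| ^+ 3 * e * x ^+ 2 + t ^+ 2 * (x ^+ 2 *+ (e <= `|x|)%R).
Proof.
move=> e0.
have H y : `|sin y - y| <= `|y| ^+ 3 /\ `|sin y - y| <= y ^+ 2.
  wlog y0 : y / 0 <= y.
    move=> H; have [y0|y0] := leP 0 y; first exact: H.
    have := H (- y); rewrite sinN -opprD normrN sqrrN normrN; apply.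
    by rewrite oppr_ge0 ltW.
  rewrite ler0_norm ?subr_le0 ?sin_le_id// opprB ger0_norm//.
  have := sin_ge_cube y0; have y3 : 0 <= y ^+ 3 by rewrite exprn_ge0.
  move=> h; split; first by lra.
  have [y1|y1] := leP y 1.
    have : y ^+ 3 <= y ^+ 2 by rewrite exprS ler_piMl ?sqr_ge0.
    by have := sqr_ge0 y; lra.
  have [y2|y2] := leP y 2.
    have : y * y ^+ 2 <= 2 * y ^+ 2 by rewrite ler_wpM2r ?sqr_ge0.
    by rewrite -exprS; have := sqr_ge0 y; lra.
  have : 2 * y <= y ^+ 2 by rewrite expr2 ler_wpM2r// ltW.
  by have := sin_geN1 y; lra.
have tx0 : 0 <= `|t| ^+ 3 * e * x ^+ 2 
  by rewrite mulr_ge0 ?sqr_ge0// mulr_ge0 ?exprn_ge0// ltW.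
have [h3 h2] := H (t * x).
have [ex|xe] := leP e `|x|; rewrite ?mulr1n ?mulr0n.
  by apply: ler_wpDl => //; rewrite -exprMn.
rewrite mulr0 addr0.
by apply: (le_trans h3); apply: cube_le; rewrite ltW.
Qed.

Lemma norm_le_oneDsqr x : `|x| <= 1 + x ^+ 2.
Proof.
rewrite -(@real_normK _ x) ?num_real//; move: (normr_ge0 x); set z := `|x|.
by have := sqr_ge0 (z - 1); rewrite sqrrB mulr1 expr1n; lra.
Qed.

Lemma expR_remainder a : 0 <= a -> `|expR (- a) - (1 - a)| <= a ^+ 2.
Proof.
move=> a0; have h := expR_ge1Dx (- a).
rewrite ger0_norm; last by lra.
have : expR (- a) <= (1 + a)^-1.
  by rewrite expRN lef_pV2 ?posrE ?expR_gt0// ?expR_ge1Dx//; lra.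
have : (1 + a)^-1 <= 1 - a + a ^+ 2.
  rewrite -[leLHS]mul1r ler_pdivrMr; last by lra.
  have -> : (1 - a + a ^+ 2) * (1 + a) = 1 + a ^+ 3 by ring.
  by rewrite lerDl exprn_ge0.
by lra.
Qed.

(** From [1 + u <= expR u] at [u = (1 - c) / c], that is [1 / c <= expR u]. *)
Lemma expR_le_of_gt0 c : 0 < c -> expR (- ((1 - c) / c)) <= c.
Proof.
move=> c0; rewrite expRN -[leRHS]invrK lef_pV2 ?posrE ?expR_gt0 ?invr_gt0//.
apply: le_trans (expR_ge1Dx _).
by rewrite mulrBl mul1r divff ?gt_eqF// addrC subrK.
Qed.

End real_bounds.

(** * Approximation by trigonometric polynomials *)

Section bernstein.
Variable R : realType.
Implicit Types (x v e C c : R) (phi : nat -> R).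

(** The Bernstein mean of [phi], i.e. the expectation of [phi] under the
    binomial law with parameters [n] and [x], by conditioning on the first
    trial; this form makes inductions on [n] free of binomial coefficients. *)
Fixpoint bernstein n phi x : R :=
  if n is m.+1 then
    x * bernstein m (phi \o S) x + (1 - x) * bernstein m phi x
  else phi 0%N.

(** A binomial variable has variance [n * x * (1 - x)] and mean [n * x], so
    its mean square distance to [c] is [n * x * (1 - x) + (n * x - c) ^+ 2]. *)
Lemma bernstein_dist n phi v e C c x : 0 <= x <= 1 ->
  (forall k, `|phi k - v| <= e + C * (k%:R - c) ^+ 2) ->
  `|bernstein n phi x - v|
    <= e + C * (n%:R * (x * (1 - x)) + (n%:R * x - c) ^+ 2).
Proof.
move=> /andP[x0 x1]; elim: n phi c => [|n IH] phi c H /=.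
  by have := H 0%N; rewrite !mulr0n !mul0r !add0r.
have -> : x * bernstein n (phi \o S) x + (1 - x) * bernstein n phi x - v =
    x * (bernstein n (phi \o S) x - v) + (1 - x) * (bernstein n phi x - v).
  by ring.
have H1 : forall k, `|(phi \o S) k - v| <= e + C * (k%:R - (c - 1)) ^+ 2.
  move=> k; have := H k.+1; rewrite -natr1 /=.
  by have -> : k%:R + 1 - c = k%:R - (c - 1) by ring.
apply: (le_trans (ler_normD _ _)); rewrite !normrM.
rewrite (ger0_norm x0) (@ger0_norm _ (1 - x)) ?subr_ge0//.
apply: (@le_trans _ _
  (x * (e + C * (n%:R * (x * (1 - x)) + (n%:R * x - (c - 1)) ^+ 2)) +
   (1 - x) * (e + C * (n%:R * (x * (1 - x)) + (n%:R * x - c) ^+ 2)))).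
  by apply: lerD; rewrite ler_wpM2l ?subr_ge0//; exact: IH.
rewrite -natr1 le_eqVlt; apply/orP; left; apply/eqP; ring.
Qed.

Lemma bernstein_approx (G : R -> R) n e C x : 0 <= x <= 1 -> 0 <= C ->
  (forall y, `|G y - G x| <= e + C * (y - x) ^+ 2) ->
  `|bernstein n.+1 (fun k => G (k%:R / n.+1%:R)) x - G x| <= e + C / n.+1%:R.
Proof.
move=> x01 C0 H; set N := n.+1%:R : R; have N0 : 0 < N by rewrite ltr0n.
apply: le_trans (@bernstein_dist _ _ _ e (C / N ^+ 2) (N * x) _ x01 _) _.
  move=> k; apply: (le_trans (H _)); rewrite lerD2l -mulrA ler_wpM2l//.
  rewrite le_eqVlt; apply/orP; left; apply/eqP; field; exact: lt0r_neq0.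
rewrite subrr expr0n addr0 lerD2l -/N -mulrA ler_wpM2l//.
have -> : N ^- 2 * (N * (x * (1 - x))) = (x * (1 - x)) * N^-1.
  by field; exact: lt0r_neq0.
apply: ler_piMl; first by rewrite invr_ge0 ltW.
by case/andP: x01 => x0 x1; apply: mulr_ile1 => //; lra.
Qed.

End bernstein.

Section trigonometric_approximation.
Variable R : realType.
Implicit Types (f g : R -> R) (t r a : R).

Inductive trig_poly : (R -> R) -> Prop :=
| trig_poly_cos a t r : trig_poly (fun y => a * cos (t * y + r))
| trig_polyD f g : trig_poly f -> trig_poly g -> trig_poly (fun y => f y + g y).

Lemma trig_poly_cst a : trig_poly (fun=> a).
Proof.
have := trig_poly_cos a 0 0; congr trig_poly; apply/funext => y.
by rewrite mul0r addr0 cos0 mulr1.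
Qed.

Lemma trig_polyM f g :
  trig_poly f -> trig_poly g -> trig_poly (fun y => f y * g y).
Proof.
move=> tf; elim: tf g => {f} [a t r|f1 f2 _ IH1 _ IH2] g tg; last first.
  have := trig_polyD (IH1 _ tg) (IH2 _ tg); congr trig_poly.
  by apply/funext => y; rewrite mulrDl.
elim: tg => {g} [b u s|g1 g2 _ IH1 _ IH2]; last first.
  have := trig_polyD IH1 IH2; congr trig_poly.
  by apply/funext => y; rewrite mulrDr.
have := trig_polyD (trig_poly_cos (a * b / 2) (t + u) (r + s))
  (trig_poly_cos (a * b / 2) (t - u) (r - s)); congr trig_poly.
apply/funext => y.
have -> : (t + u) * y + (r + s) = (t * y + r) + (u * y + s) by ring.
have -> : (t - u) * y + (r - s) = (t * y + r) - (u * y + s) by ring.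
by rewrite cosD cosB; field.
Qed.

Lemma trig_poly_bernstein n (phi : nat -> R) f :
  trig_poly f -> trig_poly (fun y => bernstein n phi (f y)).
Proof.
move=> tf; elim: n phi => [|n IH] phi /=; first exact: trig_poly_cst.
apply: trig_polyD; apply: trig_polyM => //.
apply: trig_polyD; first exact: trig_poly_cst.
have := trig_polyM (trig_poly_cst (-1)) tf; congr trig_poly.
by apply/funext => y; rewrite mulN1r.
Qed.

(** Near the diagonal the estimate is uniform continuity on the compact
    [a, b]; away from it the quadratic term absorbs the bound on [F]. *)
Lemma quadratic_modulus (F : R -> R) (a b M e : R) :
  (forall x, a <= x <= b -> {for x, continuous F}) ->
  (forall x, `|F x| <= M) -> 0 < e ->
  exists2 C, 0 <= C &
    forall x y, a <= x <= b -> `|F y - F x| <= e + C * (y - x) ^+ 2.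
Proof.
move=> cF bF e0.
have M0 : 0 <= M by apply: le_trans (bF 0).
have /compact_near_coveringP cK := @segment_compact R a b.
have : \forall d \near (0 : R)^'+, `[a, b] `<=`
    [set x | forall y, `|y - x| < d -> `|F y - F x| <= e].
  apply: (cK _ _ (fun d x => forall y, `|y - x| < d -> `|F y - F x| <= e)).
  move=> x /=; rewrite in_itv/= => /cF /cvgrPdist_lt /(_ (e / 2)) [|d /= d0 H].
    by rewrite divr_gt0.
  exists (ball x (d / 2), [set u : R | u < d / 2]) => /=.
    split; first by apply: nbhsx_ballx; rewrite divr_gt0.
    by apply: nbhs_right_lt; rewrite divr_gt0.
  move=> [x' u] /= [xx' ud] y yx'.
  have h1 : `|F x - F x'| < e / 2.
    by apply: H => /=; apply: lt_trans xx' _; rewrite ltr_pdivrMr//; lra.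
  have h2 : `|F x - F y| < e / 2.
    apply: H => /=; rewrite (le_lt_trans (ler_distD x' _ _))//.
    rewrite [ltRHS]splitr ltrD//.
    by rewrite distrC; apply: lt_trans yx' ud.
  rewrite (le_trans (ler_distD (F x) _ _))// [leRHS]splitr lerD// ltW//.
  by rewrite distrC.
move=> Hd; near (0 : R)^'+ => d.
have d0 : 0 < d by near: d; exact: nbhs_right_gt.
have H : `[a, b] `<=` [set x | forall y, `|y - x| < d -> `|F y - F x| <= e].
  by near: d.
have C0 : 0 <= 2 * M / d ^+ 2 by rewrite divr_ge0 ?mulr_ge0 ?exprn_ge0// ltW.
exists (2 * M / d ^+ 2) => //.
move=> x y xab; have [yxd|dyx] := ltP `|y - x| d.
  apply: le_trans (H x _ y yxd) _; first by rewrite /= in_itv.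
  by rewrite lerDl mulr_ge0 ?sqr_ge0.
apply: ler_wpDl; first exact: ltW.
apply: (@le_trans _ _ (2 * M)).
  by rewrite (le_trans (ler_normB _ _))// mulr2n mulrDl mul1r lerD.
rewrite mulrAC -mulrA ler_peMr ?mulr_ge0//.
rewrite -(@real_normK _ (y - x)) ?num_real// ler_pdivlMr ?exprn_gt0//.
by rewrite mul1r lerXn2r ?nnegrE// ltW.
Unshelve. all: by end_near. Qed.

(** On [-L, L] the map [y |-> sin (y / L)] is a bijection onto a segment of
    (-1, 1), so that [f] is there a continuous function of [sin (y / L)]:
    replacing this function by a Bernstein polynomial gives a trigonometric
    polynomial, which is bounded by the bound of [f] on the whole line. *)
Lemma trig_poly_approx f (M L e : R) :
  continuous f -> (forall y, `|f y| <= M) -> 0 < L -> 0 < e ->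
  exists h, [/\ trig_poly h, forall y, `|h y| <= M &
    forall y, `|y| <= L -> `|f y - h y| <= e].
Proof.
move=> cf bf L0 e0.
pose s1 : R := sin 1.
have pi1 : 1 < pi / 2 :> R.
  have := @pihalf_ge1 R; rewrite le_eqVlt => /orP[/eqP h|//].
  by have := @cos1_gt0 R; rewrite h cos_pihalf ltxx.
have s1gt0 : 0 < s1 by apply: sin_gt0_pi; rewrite ltr01/=; lra.
have s1lt1 : s1 < 1.
  rewrite -(@sin_pihalf R) /s1 ltr_sin// in_itv/=; lra.
pose F x := f (L * asin x).
have cF x : - s1 <= x <= s1 -> {for x, continuous F}.
  move=> xs; apply: (@continuous_comp _ _ _ (fun x => L * asin x) f).
    by apply: cvgM; [exact: cvg_cst|apply: continuous_asin; lra].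
  exact: cf.
have [C C0 HC] := @quadratic_modulus F (- s1) s1 M (e / 2) cF
  (fun x => bf _) (divr_gt0 e0 (ltr0Sn _ 1)).
pose clamp x := if x < - s1 then - s1 else if s1 < x then s1 else x.
have clampP x : - s1 <= clamp x <= s1.
  by rewrite /clamp; case: ltP => h1; [|case: ltP => h2]; lra.
have clamp_lip x y : (clamp y - clamp x) ^+ 2 <= (y - x) ^+ 2.
  rewrite -(@real_normK _ (y - x)) ?num_real//.
  rewrite -(@real_normK _ (clamp y - clamp x)) ?num_real//.
  rewrite lerXn2r ?nnegrE// ler_norml.
  have := ler_norm (y - x); have := ler_norm (- (y - x)).
  rewrite normrN /clamp => h3 h4.
  by case: (ltP x) => hx; [|case: (ltP s1 x) => hx'];
     case: (ltP y) => hy; [|case: (ltP s1 y) => hy'| |case: (ltP s1 y) => hy'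
     | |case: (ltP s1 y) => hy']; lra.
pose G x := F (clamp (2 * x - 1)).
have HG x y : `|G y - G x| <= e / 2 + (4 * C) * (y - x) ^+ 2.
  apply: (le_trans (HC _ _ (clampP _))); rewrite lerD2l (mulrC 4) -mulrA.
  rewrite ler_wpM2l// (le_trans (clamp_lip _ _))//.
  by rewrite le_eqVlt; apply/orP; left; apply/eqP; ring.
have [n Hn] : exists n, 4 * C / n.+1%:R <= e / 2.
  exists (Num.bound (8 * C / e)).
  rewrite ler_pdivrMr ?ltr0n//.
  have := archi_boundP (divr_ge0 (mulr_ge0 (ler0n R 8) C0) (ltW e0)).
  rewrite ltr_pdivrMr// -natr1.
  by set N := _%:R; lra.
(* [q] brings [sin (y / L)] into [0, 1], where Bernstein means live. *)
pose q y := (1 + sin (y / L)) / 2.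
have q01 y : 0 <= q y <= 1.
  by have := sin_geN1 (y / L); have := sin_le1 (y / L); rewrite /q; lra.
exists (fun y => bernstein n.+1 (fun k => G (k%:R / n.+1%:R)) (q y)); split.
- apply: trig_poly_bernstein.
  have := trig_polyD (trig_poly_cst 2^-1) (trig_poly_cos 2^-1 L^-1 (- (pi / 2))).
  congr trig_poly; apply/funext => y.
  by rewrite -/(_ - _) cosBpihalf /q (mulrC L^-1); ring.
- move=> y.
  have := @bernstein_dist _ n.+1 (fun k => G (k%:R / n.+1%:R)) 0 M 0 0 (q y)
    (q01 y); rewrite !mul0r !addr0 !subr0; apply => k.
  by rewrite subr0 mul0r addr0 bf.
- move=> y yL; have -> : f y = G (q y).
    rewrite /G /F /q.
    have -> : 2 * ((1 + sin (y / L)) / 2) - 1 = sin (y / L) by field.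
    have yL1 : -1 <= y / L <= 1.
      by rewrite ler_pdivlMr// ler_pdivrMr// mulN1r mul1r -ler_norml.
    have sinyL : - s1 <= sin (y / L) <= s1.
      rewrite /s1 -sinN !leNgt !ltr_sin ?in_itv/=; [|lra..].
      by rewrite -!leNgt.
    rewrite /clamp; case: ltP => h1; first by lra.
    case: ltP => h2; first by lra.
    rewrite sinK; last by rewrite in_itv/=; lra.
    by rewrite mulrC divfK// gt_eqF.
  rewrite distrC.
  apply: (le_trans (bernstein_approx _ (q01 y) _ (HG _))).
    by rewrite mulr_ge0.
  by rewrite [leRHS]splitr lerD2l.
Qed.
End trigonometric_approximation.

(** * Integrals with respect to a probability *)

Section integral_toolkit.
Context d (T : measurableType d) (R : realType).
Variable mu : {measure set T -> \bar R}.
Implicit Types (f g : T -> R).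

Definition Rintegrable f := mu.-integrable setT (EFin \o f).

Lemma Rintegrable_measurable f : Rintegrable f -> measurable_fun setT f.
Proof. by move=> /integrableP[/measurable_EFinP]. Qed.

Lemma RintegrableD f g :
  Rintegrable f -> Rintegrable g -> Rintegrable (fun w => f w + g w).
Proof. by move=> hf hg; exact: (integrableD measurableT hf hg). Qed.

Lemma RintegrableZ c f : Rintegrable f -> Rintegrable (fun w => c * f w).
Proof. by move=> hf; exact: (integrableZl measurableT c hf). Qed.

Lemma RintegrableB f g :
  Rintegrable f -> Rintegrable g -> Rintegrable (fun w => f w - g w).
Proof. by move=> hf hg; exact: (integrableB measurableT hf hg). Qed.

Lemma Rintegrable_le f g : measurable_fun setT f -> Rintegrable g ->
  (forall w, `|f w| <= g w) -> Rintegrable f.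
Proof.
move=> mf ig fg.
apply: (@le_integrable _ _ _ _ _ measurableT _ (EFin \o g)) => //.
  exact/measurable_EFinP.
by move=> w _ /=; rewrite lee_fin (le_trans (fg w))// ler_norm.
Qed.

Lemma RintegralT_D f g : Rintegrable f -> Rintegrable g ->
  \int[mu]_w (f w + g w) = \int[mu]_w f w + \int[mu]_w g w.
Proof. by move=> hf hg; exact: RintegralD. Qed.

Lemma RintegralT_Z c f : Rintegrable f ->
  \int[mu]_w (c * f w) = c * \int[mu]_w f w.
Proof. by move=> hf; exact: RintegralZl. Qed.

Lemma Rintegrable_sum I (s : seq I) (F : I -> T -> R) :
  (forall i, Rintegrable (F i)) -> Rintegrable (fun w => \sum_(i <- s) F i w).
Proof.
move=> iF; elim: s => [|i s IH].
  under eq_fun do rewrite big_nil; exact: integrable0.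
under eq_fun do rewrite big_cons; exact: RintegrableD.
Qed.

Lemma RintegralT_sum I (s : seq I) (F : I -> T -> R) :
  (forall i, Rintegrable (F i)) ->
  \int[mu]_w (\sum_(i <- s) F i w) = \sum_(i <- s) \int[mu]_w F i w.
Proof.
move=> iF; elim: s => [|i s IH].
  under eq_Rintegral do rewrite big_nil.
  by rewrite big_nil /Rintegral integral0.
under eq_Rintegral do rewrite big_cons.
by rewrite RintegralT_D ?IH ?big_cons//; exact: Rintegrable_sum.
Qed.

Lemma le_RintegralT f g : Rintegrable f -> Rintegrable g ->
  (forall w, f w <= g w) -> \int[mu]_w f w <= \int[mu]_w g w.
Proof. by move=> hf hg fg; apply: le_Rintegral. Qed.

Lemma Rintegral_dominated_cvg (f_ : nat -> T -> R) f g :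
  (forall n, measurable_fun setT (f_ n)) -> measurable_fun setT f ->
  Rintegrable g -> (forall n w, `|f_ n w| <= g w) ->
  (forall w, f_ n w @[n --> \oo] --> f w) ->
  \int[mu]_w f_ n w @[n --> \oo] --> \int[mu]_w f w.
Proof.
move=> mf_ mf ig fg ff.
have [] := @dominated_convergence _ _ _ mu _ measurableT
  (fun n w => (f_ n w)%:E) (EFin \o f) (EFin \o g).
- by move=> n; exact/measurable_EFinP.
- exact/measurable_EFinP.
- by apply: aeW => w _; apply: cvg_EFin; [exact: nearW|exact: ff].
- exact: ig.
- by apply: aeW => w n _; rewrite lee_fin.
move=> intf _; rewrite /Rintegral => H; apply: fine_cvg; rewrite fineK//.
exact: integrable_fin_num.
Qed.

End integral_toolkit.

Section expectation_toolkit.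
Context d (T : measurableType d) (R : realType) (P : probability T R).
Implicit Types (f g : T -> R).
Import HBNNSimple.

Lemma Rintegrable_cst c : Rintegrable P (fun=> c).
Proof. exact: finite_measure_integrable_cst. Qed.

Lemma Rintegrable_bounded f M : measurable_fun setT f ->
  (forall w, `|f w| <= M) -> Rintegrable P f.
Proof. by move=> mf; exact/Rintegrable_le/Rintegrable_cst. Qed.

Lemma Rintegral_prob_cst c : \int[P]_w c = c.
Proof.
rewrite /Rintegral integral_cst//=. by rewrite probability_setT mule1.
Qed.

Lemma le_norm_Rintegral f g : measurable_fun setT f -> Rintegrable P g ->
  (forall w, `|f w| <= g w) -> `|\int[P]_w f w| <= \int[P]_w g w.
Proof.
move=> mf ig fg; have hf := Rintegrable_le mf ig fg.
apply: (le_trans (le_normr_Rintegral _ hf)) => //.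
apply: le_RintegralT => //; apply: Rintegrable_le ig _ => //.
  exact: measurableT_comp.
by move=> w; rewrite normr_id.
Qed.

(** Proportionality to [c] passes from indicators to simple functions by
    linearity, and from these to bounded functions by dominated convergence. *)
Lemma Rintegral_comp_mul (X W : T -> R) (c M : R) :
  measurable_fun setT X -> measurable_fun setT W -> (forall w, `|W w| <= M) ->
  (forall A : set R, measurable A ->
    \int[P]_w (\1_A (X w) * W w) = c * \int[P]_w \1_A (X w)) ->
  forall (f : R -> R) K, measurable_fun setT f -> (forall x, `|f x| <= K) ->
  \int[P]_w (f (X w) * W w) = c * \int[P]_w f (X w).
Proof.
move=> mX mW bW Hind.
have M0 : 0 <= M.
  have [w _] : (setT : set T) !=set0.
    apply/set0P/eqP => h; have := probability_setT P.
    by rewrite h measure0 => /eqP; rewrite eq_sym onee_eq0.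
  exact: le_trans (bW w).
have mfX (f : R -> R) : measurable_fun setT f -> measurable_fun setT (f \o X).
  by move=> mf; apply: measurableT_comp.
have iW f K : measurable_fun setT f -> (forall w, `|f w| <= K) ->
    Rintegrable P (fun w => f w * W w).
  move=> mf bf; apply: (@Rintegrable_bounded _ (K * M)).
    exact: measurable_funM.
  by move=> w; rewrite normrM ler_pM.
have pos : forall (f : R -> R) K, measurable_fun setT f ->
    (forall x, 0 <= f x <= K) ->
    \int[P]_w (f (X w) * W w) = c * \int[P]_w f (X w).
  move=> f K mf bf.
  have mf' : measurable_fun setT (EFin \o f) by exact/measurable_EFinP.
  pose h := nnsfun_approx measurableT mf'.
  have f0 x : setT x -> (0 <= (EFin \o f) x)%E.
    by move=> _; rewrite lee_fin; case/andP: (bf x).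
  have hf n x : 0 <= h n x <= f x.
    apply/andP; split; first by [].
    by rewrite -lee_fin nnsfun_approxE; exact: le_approx.
  have hK n x : `|h n x| <= K.
    case/andP: (hf n x) => h1 h2; rewrite ger0_norm// (le_trans h2)//.
    by case/andP: (bf x).
  have hcvg x : h n x @[n --> \oo] --> f x.
    by have := cvg_nnsfun_approx measurableT mf' f0 (x := x) I => /fine_cvgP[].
  have mh n : measurable_fun setT (h n) by [].
  have Hh n : \int[P]_w (h n (X w) * W w) = c * \int[P]_w h n (X w).
    have hE x : h n x = \sum_(y <- fset_set (range (h n)))
        y * \1_(h n @^-1` [set y]) x by rewrite fimfunE fsbig_finite.
    have mA y : measurable (h n @^-1` [set y]).
      by rewrite -[_ @^-1` _]setTI; exact: mh.
    have mI y : measurable_fun setT (fun w => \1_(h n @^-1` [set y]) (X w) : R).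
      by apply: (mfX (\1_(h n @^-1` [set y]))); exact: measurable_indic.
    have bI y w : `|\1_(h n @^-1` [set y]) (X w) : R| <= 1.
      by rewrite indicE; case: (_ \in _); rewrite ?normr1 ?normr0.
    under eq_Rintegral => w _ do rewrite hE mulr_suml.
    under [in RHS]eq_Rintegral => w _ do rewrite hE.
    rewrite !RintegralT_sum.
    - rewrite mulr_sumr; apply: eq_bigr => y _.
      under eq_Rintegral => w _ do rewrite -mulrA.
      rewrite !RintegralT_Z ?Hind//; first by rewrite mulrCA.
      + exact: Rintegrable_bounded (mI y) (bI y).
      + exact: iW (mI y) (bI y).
    - by move=> y; apply: RintegrableZ; exact: Rintegrable_bounded (mI y) (bI y).
    - move=> y; under eq_fun do rewrite -mulrA.
      by apply: RintegrableZ; exact: iW (mI y) (bI y).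
  have L1 : \int[P]_w (h n (X w) * W w) @[n --> \oo] -->
      \int[P]_w (f (X w) * W w).
    apply: (@Rintegral_dominated_cvg _ _ _ _ _ _ (fun=> K * M)).
    - by move=> n; apply: measurable_funM => //; exact: mfX.
    - by apply: measurable_funM => //; exact: mfX.
    - exact: Rintegrable_cst.
    - by move=> n w; rewrite normrM ler_pM.
    - by move=> w; apply: cvgM; [exact: hcvg|exact: cvg_cst].
  have L2 : c * \int[P]_w h n (X w) @[n --> \oo] --> c * \int[P]_w f (X w).
    apply: cvgM; first exact: cvg_cst.
    apply: (@Rintegral_dominated_cvg _ _ _ _ _ _ (fun=> K)).
    - by move=> n; exact: mfX.
    - exact: mfX.
    - exact: Rintegrable_cst.
    - by [].
    - by move=> w; exact: hcvg.
  by move: L1; rewrite (funext Hh) => L1; exact: (cvg_unique _ L1 L2).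
move=> f K mf bf.
have K0 : 0 <= K by apply: le_trans (bf 0).
have mfK : measurable_fun setT (fun x => f x + K) by exact: measurable_funD.
have := @pos _ (K + K) mfK; have := @pos (fun=> K) K (measurable_cst _).
rewrite K0 lexx => /(_ (fun=> isT)) h1 h2.
have : forall x, 0 <= f x + K <= K + K.
  by move=> x; have := bf x; rewrite ler_norml; lra.
move/h2; under eq_Rintegral => w _ do rewrite mulrDl.
rewrite !RintegralT_D ?h1 ?mulrDr//.
- by move/addIr.
- by apply: (@iW (f \o X) K) => [|w]; [exact: mfX|exact: bf].
- by apply: (@iW (fun=> K) K) => // w; rewrite ger0_norm.
- by apply: (@Rintegrable_bounded (f \o X) K) => [|w]; [exact: mfX|exact: bf].
- exact: Rintegrable_cst.
Qed.

End expectation_toolkit.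

(** * Cosine means of sums of independent variables *)

Section independent_sums.
Context d (T : measurableType d) (R : realType) (P : probability T R).
Variables (X : nat -> {RV P >-> R}) (D : set nat) (a : nat).
Hypothesis indepX : independent_RVs D X.
Hypothesis aD : forall k, (a <= k)%N -> D k.

Definition partial_sum m (w : T) : R := \sum_(a <= k < a + m) X k w.

Lemma measurable_partial_sum m : measurable_fun setT (partial_sum m).
Proof. by apply: measurable_sum => k. Qed.

Lemma partial_sumS m w : partial_sum m.+1 w = partial_sum m w + X (a + m)%N w.
Proof. by rewrite /partial_sum addnS big_nat_recr ?leq_addr. Qed.

Lemma Rintegral_indic_comp (A : set R) k : measurable A ->
  \int[P]_w \1_A (X k w) = fine (P (X k @^-1` A)).
Proof.
move=> mA; rewrite /Rintegral; congr fine.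
transitivity (\int[P]_w (\1_(X k @^-1` A) w)%:E)%E; first by [].
rewrite integral_indic ?setIT//.
by rewrite -[_ @^-1` _]setTI; exact: measurable_funP.
Qed.

Lemma prod_indic_comp (s : seq nat) (A : nat -> set R) w :
  \prod_(k <- s) \1_(A k) (X k w) =
  \1_(\bigcap_(k in [set` s]) (X k @^-1` A k)) w :> R.
Proof.
rewrite indicE; elim: s => [|k s IH].
  by rewrite big_nil mem_set// => i.
rewrite big_cons IH indicE -natrM mulnb; congr (nat_of_bool _)%:R.
apply/idP/idP; rewrite !inE.
- move=> /andP[/set_mem h1 /set_mem h2] i /=.
  by rewrite inE => /predU1P[->//|/h2].
- move=> h; apply/andP; split; first by apply/mem_set/h => /=; rewrite mem_head.
  by apply/mem_set => i /= si; apply: h => /=; rewrite inE si orbT.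
Qed.

Lemma indep_prod_indic (s : seq nat) (A : nat -> set R) :
  uniq s -> all (leq a) s -> (forall k, measurable (A k)) ->
  \int[P]_w (\prod_(k <- s) \1_(A k) (X k w)) =
  \prod_(k <- s) \int[P]_w \1_(A k) (X k w).
Proof.
move=> us sa mA.
have mXA k : measurable (X k @^-1` A k).
  by rewrite -[_ @^-1` _]setTI; exact: measurable_funP.
have -> : \int[P]_w (\prod_(k <- s) \1_(A k) (X k w)) =
    fine (P (\bigcap_(k in [set` s]) (X k @^-1` A k))).
  under eq_Rintegral => w _ do rewrite prod_indic_comp.
  rewrite /Rintegral integral_indic ?setIT//.
  by apply: bigcap_measurableType => k _; exact: mXA.
pose J := [fset k in s]%fset.
have JE : [set` J] = [set` s] by apply/seteqP; split => k /=; rewrite in_fset.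
have -> : \prod_(k <- s) \int[P]_w \1_(A k) (X k w) =
    \prod_(k <- s) fine (P (X k @^-1` A k)).
  by apply: eq_bigr => k _; rewrite Rintegral_indic_comp.
rewrite -JE indepX//; last first.
  by move=> k /=; rewrite in_fset => ks; apply: aD; exact: (allP sa).
rewrite (perm_big s)/=; first last.
  by apply: uniq_perm => //; [exact: fset_uniq|move=> k; rewrite in_fset].
elim: s {us sa J JE} => [|k s IH]; first by rewrite !big_nil.
rewrite !big_cons -IH fineM ?fin_num_measure//.
apply: (big_ind (fun x : \bar R => x \is a fin_num)) => // [x y|i _].
  exact: fin_numM.
exact: fin_num_measure.
Qed.

Variable t : R.

Let C m th := \int[P]_w cos (th + t * partial_sum m w).

Let measurable_cos_sum m th :
  measurable_fun setT (fun w => cos (th + t * partial_sum m w)).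
Proof.
apply: measurableT_comp.
  by apply: continuous_measurable_fun; exact: continuous_cos.
apply: measurable_funD => //; apply: measurable_funM => //.
exact: measurable_partial_sum.
Qed.

Let cosD_sum m th w : cos (th + t * partial_sum m.+1 w) =
  cos (t * X (a + m)%N w) * cos (th + t * partial_sum m w) +
  sin (t * X (a + m)%N w) * cos (th + pi / 2 + t * partial_sum m w).
Proof.
rewrite partial_sumS (addrAC th) cosDpihalf mulrDr addrA cosD; ring.
Qed.

Let bounded_prod_indic (s : seq nat) (A : nat -> set R) w :
  0 <= (\prod_(k <- s) \1_(A k) (X k w) : R) <= 1.
Proof.
by rewrite prod_indic_comp indicE; case: (_ \in _); rewrite ?lexx ?ler01.
Qed.

Let measurable_prod_indic (s : seq nat) (A : nat -> set R) :
  (forall k, measurable (A k)) ->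
  measurable_fun setT (fun w => \prod_(k <- s) \1_(A k) (X k w) : R).
Proof.
by move=> mA; apply: measurable_prod => k _; apply: measurableT_comp.
Qed.

(** The events on the later variables are carried along: they are what makes
    the induction possible when all that is known is a product rule for
    events. *)
Let sum_indep m := forall (s : seq nat) (A : nat -> set R) th,
  uniq s -> all (leq (a + m)) s -> (forall k, measurable (A k)) ->
  \int[P]_w (cos (th + t * partial_sum m w) * \prod_(k <- s) \1_(A k) (X k w)) =
  C m th * \prod_(k <- s) \int[P]_w \1_(A k) (X k w).

Let sum_indep_next m (s : seq nat) (A : nat -> set R) th : sum_indep m ->
  uniq s -> all (leq (a + m.+1)) s -> (forall k, measurable (A k)) ->
  \int[P]_w (cos (th + t * partial_sum m.+1 w) *
    \prod_(k <- s) \1_(A k) (X k w)) =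
  (C m th * \int[P]_w cos (t * X (a + m)%N w) +
   C m (th + pi / 2) * \int[P]_w sin (t * X (a + m)%N w)) *
  \prod_(k <- s) \int[P]_w \1_(A k) (X k w).
Proof.
move=> IH us sa mA; set j := (a + m)%N.
have key (f : R -> R) th' :
    measurable_fun setT f -> (forall x, `|f x| <= 1) ->
    \int[P]_w (f (X j w) * (cos (th' + t * partial_sum m w) *
      \prod_(k <- s) \1_(A k) (X k w))) =
    C m th' * \prod_(k <- s) (\int[P]_w \1_(A k) (X k w)) *
      \int[P]_w f (X j w).
  move=> mf bf.
  have sa' : all (leq j.+1) s by rewrite /j -addnS.
  apply: (@Rintegral_comp_mul _ _ _ _ _ _ _ 1 _ _ _ _ f 1) => //.
  - by apply: measurable_funM => //; exact: measurable_prod_indic.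
  - move=> w; rewrite normrM mulr_ile1// ?cos_max//.
    by case/andP: (bounded_prod_indic s A w) => h1 h2; rewrite ger0_norm.
  - move=> B mB; pose A' k := if k == j then B else A k.
    have A's k : k \in s -> A' k = A k.
      move=> ks; rewrite /A'; case: eqP => // kj.
      by have := allP sa' k ks; rewrite kj /= ltnn.
    have := IH (j :: s) A' th'; rewrite big_cons.
    have -> : \prod_(k <- s) \int[P]_w \1_(A' k) (X k w) =
        \prod_(k <- s) \int[P]_w \1_(A k) (X k w).
      by apply: eq_big_seq => k ks; rewrite A's.
    have -> : A' j = B by rewrite /A' eqxx.
    rewrite [in X in _ -> X]mulrAC -[in X in _ -> X]mulrA => <-.
    + apply: eq_Rintegral => w _; rewrite big_cons /A' eqxx mulrCA.
      congr (_ * (_ * _)); apply: eq_big_seq => k ks.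
      by rewrite -/(A' k) A's.
    + rewrite /= us andbT; apply/negP => js.
      by have := allP sa' j js; rewrite ltnn.
    + rewrite /= leqnn /=; apply: sub_all sa' => k; exact: ltnW.
    + by move=> k; rewrite /A'; case: ifP.
have mcos : measurable_fun setT (fun x => cos (t * x)).
  apply: measurableT_comp.
    by apply: continuous_measurable_fun; exact: continuous_cos.
  exact: measurable_funM.
have msin : measurable_fun setT (fun x => sin (t * x)).
  apply: measurableT_comp.
    by apply: continuous_measurable_fun; exact: continuous_sin.
  exact: measurable_funM.
under eq_Rintegral => w _ do rewrite cosD_sum mulrDl -!mulrA.
have bI w : `|\prod_(k <- s) \1_(A k) (X k w) : R| <= 1.
  by case/andP: (bounded_prod_indic s A w) => h1 h2; rewrite ger0_norm.
rewrite RintegralT_D.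
- rewrite (key (fun x => cos (t * x))) ?(key (fun x => sin (t * x)))//.
  + ring.
  + by move=> x; exact: sin_max.
  + by move=> x; exact: cos_max.
- apply: (@Rintegrable_bounded _ _ _ _ _ 1).
    apply: measurable_funM; first exact: (measurableT_comp mcos).
    by apply: measurable_funM => //; exact: measurable_prod_indic.
  move=> w; rewrite !normrM.
  by rewrite !mulr_ile1 ?mulr_ge0// ?cos_max ?mulr_ile1// cos_max.
- apply: (@Rintegrable_bounded _ _ _ _ _ 1).
    apply: measurable_funM; first exact: (measurableT_comp msin).
    by apply: measurable_funM => //; exact: measurable_prod_indic.
  move=> w; rewrite !normrM.
  by rewrite !mulr_ile1 ?mulr_ge0// ?sin_max ?mulr_ile1// cos_max.
Qed.

Let sum_indepT m : sum_indep m.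
Proof.
elim: m => [|m IH] s A th us sa mA.
  rewrite addn0 in sa.
  have E w : cos (th + t * partial_sum 0 w) = cos th.
    by rewrite /partial_sum addn0 big_geq// mulr0 addr0.
  rewrite /C; under [in RHS]eq_Rintegral => w _ do rewrite E.
  under eq_Rintegral => w _ do rewrite E.
  rewrite Rintegral_prob_cst RintegralT_Z ?indep_prod_indic//.
  apply: (@Rintegrable_bounded _ _ _ _ _ 1); first exact: measurable_prod_indic.
  by move=> w; case/andP: (bounded_prod_indic s A w) => h1 h2; rewrite ger0_norm.
rewrite sum_indep_next//; congr (_ * _).
have := @sum_indep_next m [::] A th IH isT isT mA.
rewrite big_nil mulr1 => <-; apply: eq_Rintegral => w _.
by rewrite big_nil mulr1.
Qed.

(** This is the product rule for characteristic functions in real terms: the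
    phase [th] encodes the real and the imaginary part at once, as
    [cos (th + pi / 2)] is [- sin th]. *)
Lemma Rintegral_cos_sumS m th :
  \int[P]_w cos (th + t * partial_sum m.+1 w) =
  \int[P]_w cos (th + t * partial_sum m w) *
    \int[P]_w cos (t * X (a + m)%N w) +
  \int[P]_w cos (th + pi / 2 + t * partial_sum m w) *
    \int[P]_w sin (t * X (a + m)%N w).
Proof.
have := @sum_indep_next m [::] (fun=> setT) th (@sum_indepT m) isT isT
  (fun=> measurableT).
rewrite big_nil mulr1 => <-; apply: eq_Rintegral => w _.
by rewrite big_nil mulr1.
Qed.

End independent_sums.

(** * The characteristic function of the standard normal law *)

Section standard_normal.
Variable R : realType.
#[local] Notation mu := (@lebesgue_measure R).
#[local] Notation pdf := (normal_pdf (0 : R) 1).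
#[local] Notation N01 := (normal_prob (0 : R) 1).
Implicit Types (f g : R -> R) (t th y : R).

(** The density is a Radon-Nikodym derivative, hence almost everywhere equal to
    the one through which integrals are transferred. *)
Lemma ge0_integral_normal_prob f : measurable_fun setT f ->
  (forall y, 0 <= f y) ->
  (\int[N01]_y (f y)%:E = \int[mu]_y (f y * pdf y)%:E)%E.
Proof.
move=> mf f0; have dom := normal_prob_dominates (0 : R) 1.
have mE : measurable_fun setT (EFin \o f) by exact/measurable_EFinP.
under [RHS]eq_integral do rewrite EFinM.
rewrite -(Radon_Nikodym_SigmaFinite.change_of_variables dom)//=.
have mpdf : measurable_fun setT (EFin \o pdf).
  by apply/measurable_EFinP; exact: measurable_normal_pdf.
have iRN := Radon_Nikodym_SigmaFinite.f_integrable dom.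
apply: ae_eq_integral => //.
- by apply: emeasurable_funM => //; exact: (measurable_int mu).
- exact: emeasurable_funM.
- apply: ae_eqe_mul2l; apply: integral_ae_eq => //.
  by move=> E _ mE'; rewrite -Radon_Nikodym_SigmaFinite.f_integral.
Qed.

Lemma Rintegrable_normal_prob f : measurable_fun setT f ->
  Rintegrable mu (fun y => f y * pdf y) -> Rintegrable N01 f.
Proof.
move=> mf /integrableP[_]; set I := (X in (X < _)%E) => Ioo.
apply/integrableP; split; first exact/measurable_EFinP.
rewrite (_ : (\int[_]_y _)%E = I)//.
transitivity (\int[N01]_y (`|f y|%R%:E))%E; first by [].
rewrite ge0_integral_normal_prob//; last exact: measurableT_comp.
by apply: eq_integral => y _ /=; rewrite normrM (ger0_norm (normal_pdf_ge0 _ _ _)).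
Qed.

Lemma Rintegral_normal_prob f : measurable_fun setT f ->
  Rintegrable mu (fun y => f y * pdf y) ->
  \int[N01]_y f y = \int[mu]_y (f y * pdf y).
Proof.
move=> mf ifp; have iN := Rintegrable_normal_prob mf ifp.
have mn : measurable_fun setT (fun y => `|f y|) by exact: measurableT_comp.
have inp : Rintegrable mu (fun y => `|f y| * pdf y).
  apply: (@Rintegrable_le _ _ _ mu _ (fun y => `|f y * pdf y|)).
  - by apply: measurable_funM => //; exact: measurable_normal_pdf.
  - exact: (integrable_norm ifp).
  - by move=> y; rewrite !normrM normr_id.
have iNn := Rintegrable_normal_prob mn inp.
have pos g : measurable_fun setT g -> (forall y, 0 <= g y) ->
    \int[N01]_y g y = \int[mu]_y (g y * pdf y).
  by move=> mg g0; rewrite /Rintegral ge0_integral_normal_prob.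
have h1 := pos _ mn (fun y => normr_ge0 _).
have h2 : \int[N01]_y (f y + `|f y|) = \int[mu]_y ((f y + `|f y|) * pdf y).
  apply: pos; first exact: measurable_funD.
  by move=> y; rewrite -lerBlDl sub0r -normrN ler_norm.
move: h2; under [in RHS]eq_Rintegral => y _ do rewrite mulrDl.
by rewrite !RintegralT_D// h1 => /addIr.
Qed.

(** Any polynomial factor is absorbed by halving the Gaussian exponent. *)
Lemma Rintegrable_sqr_normal_pdf :
  Rintegrable mu (fun y : R => (1 + y ^+ 2) * pdf y).
Proof.
pose s : R := Num.sqrt 2; have s2 : s ^+ 2 = 2 by rewrite sqr_sqrtr.
have s0 : s != 0 by rewrite gt_eqF// sqrtr_gt0.
pose K : R := 4 * (normal_peak 1 / normal_peak s).
apply: (@Rintegrable_le _ _ _ mu _ (fun y => K * normal_pdf 0 s y)).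
- apply: measurable_funM; last exact: measurable_normal_pdf.
  by apply: measurable_funD => //; exact: measurable_funX.
- by apply: RintegrableZ; exact: integrable_normal_pdf.
move=> y; rewrite ger0_norm ?mulr_ge0 ?normal_pdf_ge0 ?addr_ge0 ?sqr_ge0//.
rewrite !normal_pdfE ?oner_eq0// /normal_fun /K !subr0 s2.
have ps0 : normal_peak s != 0 by rewrite gt_eqF// normal_peak_gt0.
rewrite -[leRHS]mulrA [X in 4 * X](_ : _ =
  normal_peak 1 * expR (- y ^+ 2 / (2 *+ 2))); last first.
  by rewrite mulrA divfK.
rewrite mulrCA [leRHS]mulrCA ler_wpM2l ?normal_peak_ge0//.
have -> : - y ^+ 2 / (1 ^+ 2 *+ 2) = - y ^+ 2 / (2 *+ 2) + - (y ^+ 2 / 4).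
  by field.
rewrite expRD mulrCA [leRHS]mulrC ler_wpM2l ?expR_ge0//.
rewrite expRN ler_pdivrMr ?expR_gt0//.
by have := expR_ge1Dx (y ^+ 2 / 4); lra.
Qed.

Lemma Rintegrable_normal_sqr : Rintegrable N01 (fun y : R => 1 + y ^+ 2).
Proof.
apply: Rintegrable_normal_prob; last exact: Rintegrable_sqr_normal_pdf.
by apply: measurable_funD => //; exact: measurable_funX.
Qed.

Lemma is_derive_normal_pdf y : is_derive y (1 : R) pdf (- y * pdf y).
Proof.
rewrite normal_pdfE ?oner_eq0// /normal_fun.
apply: is_derive_eq.
rewrite /GRing.scale/= !subr0.
by field.
Qed.

Lemma normal_pdf_le_inv (n : nat) y : y ^+ 2 = n.+1%:R ^+ 2 ->
  pdf y <= 2 * normal_peak 1 * n.+1%:R^-1.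
Proof.
move=> yn; rewrite normal_pdfE ?oner_eq0// /normal_fun subr0 yn.
set N := n.+1%:R : R; have N0 : 0 < N by rewrite ltr0n.
rewrite (mulrC 2) -mulrA ler_wpM2l ?normal_peak_ge0//.
have -> : - N ^+ 2 / (1 ^+ 2 *+ 2) = - (N ^+ 2 / 2) by field.
rewrite expRN -[2 / N]invrK lef_pV2 ?posrE ?expR_gt0 ?invr_gt0 ?divr_gt0//.
apply: le_trans (expR_ge1Dx _); rewrite invf_div.
have := sqr_ge0 (N - 1); rewrite sqrrB mulr1 expr1n; lra.
Qed.

(** The integrand is the derivative of [sin (th + t * y) * pdf y], which vanishes
    at infinity, because [pdf] has derivative [- y * pdf y]. *)
Lemma normal_stein_sin t th :
  \int[mu]_y (t * cos (th + t * y) * pdf y - y * sin (th + t * y) * pdf y) = 0.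
Proof.
set D := fun y => t * cos (th + t * y) * pdf y - y * sin (th + t * y) * pdf y.
pose F y := sin (th + t * y) * pdf y.
have dF y : is_derive y (1 : R) F (D y).
  have := is_derive_normal_pdf y => h.
  apply: is_derive_eq; rewrite /GRing.scale/= /D; ring.
have cD : continuous D.
  have cpdf : continuous pdf by apply: continuous_normal_pdf; rewrite oner_eq0.
  have clin y : th + t * x @[x --> y] --> th + t * y.
    by apply: cvgD; [exact: cvg_cst|apply: cvgM; [exact: cvg_cst|exact: cvg_id]].
  move=> y; apply: cvgB; apply: cvgM; try exact: cpdf; apply: cvgM.
  - exact: cvg_cst.
  - by apply: (cvg_comp _ _ (clin y)); exact: continuous_cos.
  - exact: cvg_id.
  - by apply: (cvg_comp _ _ (clin y)); exact: continuous_sin.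
have mD : measurable_fun setT D by exact: continuous_measurable_fun.
have iG : Rintegrable mu (fun y => (1 + `|t|) * ((1 + y ^+ 2) * pdf y)).
  by apply: RintegrableZ; exact: Rintegrable_sqr_normal_pdf.
have DG y : `|D y| <= (1 + `|t|) * ((1 + y ^+ 2) * pdf y).
  rewrite /D -mulrBl normrM (ger0_norm (normal_pdf_ge0 _ _ _)) mulrA.
  rewrite ler_wpM2r ?normal_pdf_ge0//.
  have h1 : `|t * cos (th + t * y)| <= `|t|.
    by rewrite normrM ler_piMr// cos_max.
  have h2 : `|y * sin (th + t * y)| <= `|y|.
    by rewrite normrM ler_piMr// sin_max.
  apply: (le_trans (ler_normB _ _)); rewrite mulrDl mul1r addrC lerD//.
    exact: le_trans (norm_le_oneDsqr y).
  by apply: (le_trans h1); rewrite ler_peMr// lerDl sqr_ge0.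
pose I n := `[- n.+1%:R, n.+1%:R]%classic : set R.
have FTC n : \int[mu]_(y in I n) D y = F n.+1%:R - F (- n.+1%:R).
  rewrite /Rintegral (@continuous_FTC2 _ D F)//.
  - by rewrite (@lt_trans _ _ 0)// ?oppr_lt0 ltr0n.
  - exact: continuous_subspaceT.
  - have dF' x : derivable F x 1 by apply: ex_derive.
    have cF : continuous F.
      by move=> x; apply: differentiable_continuous; exact/derivable1_diffP.
    split; first by move=> x _.
    + by apply: cvg_at_right_filter; exact: cF.
    + by apply: cvg_at_left_filter; exact: cF.
  - by move=> x _; rewrite derive1E; apply: derive_val.
have L1 : \int[mu]_(y in I n) D y @[n --> \oo] --> \int[mu]_y D y.
  under eq_fun do rewrite Rintegral_mkcond.
  apply: (@Rintegral_dominated_cvg _ _ _ mu (fun n => D \_ (I n)) D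
    (fun y => (1 + `|t|) * ((1 + y ^+ 2) * pdf y))) => //.
  - move=> n.
    have mI : measurable (I n : set (measurableTypeR R)).
      exact: measurable_itv.
    apply: ((measurable_restrictT D mI).1 (measurable_funTS mD)).
  - move=> n y; rewrite patchE; case: ifP => _ //.
    by rewrite normr0; apply: le_trans (DG y).
  - move=> y; apply: cvg_near_cst; near=> n.
    rewrite patchE mem_set// /I /= in_itv/= -ler_norml.
    near: n; exists (Num.bound `|y|) => //= n /= yn.
    apply: (le_trans (ltW (archi_boundP (normr_ge0 y)))).
    by rewrite ler_nat ltnW.
have L2 : \int[mu]_(y in I n) D y @[n --> \oo] --> 0.
  apply: norm_cvg0; apply: (@squeeze_cvgr _ _ _ _ (cst 0)
    (fun n => 4 * normal_peak 1 * n.+1%:R^-1)).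
  - near=> n; rewrite normr_ge0 FTC/= (le_trans (ler_normB _ _))//.
    have H y : y ^+ 2 = n.+1%:R ^+ 2 ->
        `|F y| <= 2 * normal_peak 1 * n.+1%:R^-1.
      move=> /normal_pdf_le_inv; apply: le_trans.
      rewrite normrM (ger0_norm (normal_pdf_ge0 _ _ _)).
      by rewrite ler_piMl ?normal_pdf_ge0// sin_max.
    apply: (le_trans (lerD (H _ erefl) (H _ _))); first by rewrite sqrrN.
    by rewrite -mulrDl -mulrDl -natrD.
  - exact: cvg_cst.
  - rewrite -[X in _ --> X](mulr0 (4 * normal_peak 1)).
    by apply: cvgM; [exact: cvg_cst|exact: cvg_harmonic].
exact: (cvg_unique _ L1 L2).
Unshelve. all: by end_near. Qed.

(** As a function of [t] this integral solves [K' = - t * K]. *)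
Lemma Rintegral_normal_cos t th :
  \int[N01]_y cos (th + t * y) = expR (- (t ^+ 2 / 2)) * cos th.
Proof.
pose K u := \int[N01]_y cos (th + u * y).
have mlin u : measurable_fun setT (fun y => th + u * y).
  by apply: measurable_funD => //; exact: measurable_funM.
have mcos u : measurable_fun setT (fun y => cos (th + u * y)).
  apply: measurableT_comp (mlin u).
  by apply: continuous_measurable_fun; exact: continuous_cos.
have msin u : measurable_fun setT (fun y => sin (th + u * y)).
  apply: measurableT_comp (mlin u).
  by apply: continuous_measurable_fun; exact: continuous_sin.
have mysin u : measurable_fun setT (fun y => y * sin (th + u * y)).
  by apply: measurable_funM => //; exact: msin.
have iK u : Rintegrable N01 (fun y => cos (th + u * y)).
  by apply: (@Rintegrable_bounded _ _ _ _ _ 1) => [|y]; [exact: mcos|exact: cos_max].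
have dcos u y : is_derive u (1 : R) (fun x => cos (th + x * y))
    (- (y * sin (th + u * y))).
  by apply: is_derive_eq; rewrite /GRing.scale/=; ring.
have dK u : is_derive u (1 : R) K (\int[N01]_y (- (y * sin (th + u * y)))).
  have u_in : (u - 1 < u < u + 1)%R by lra.
  have Iu : `]u - 1, u + 1[%classic u by rewrite /= in_itv.
  have derf1 x y : `]u - 1, u + 1[%classic x -> setT y ->
      derivable ((fun x y => cos (th + x * y))^~ y) x 1.
    by move=> _ _; apply: ex_derive.
  have G_ub x y : `]u - 1, u + 1[%classic x -> setT y ->
      `|partial1of2 (fun x y => cos (th + x * y)) x y| <= 1 + y ^+ 2.
    move=> _ _; rewrite partial1of2E derive_val normrN normrM.
    by apply: le_trans (norm_le_oneDsqr y); rewrite ler_piMr// sin_max.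
  have G0 y : 0 <= 1 + y ^+ 2 by rewrite addr_ge0 ?sqr_ge0.
  have iK' x : `]u - 1, u + 1[%classic x ->
      N01.-integrable setT (EFin \o (fun y => cos (th + x * y))).
    by move=> _; exact: iK.
  have h1 := derivable_under_integral measurableT Iu iK' derf1 G0
    Rintegrable_normal_sqr G_ub.
  have h2 := differentiation_under_integral measurableT Iu iK' derf1 G0
    Rintegrable_normal_sqr G_ub.
  apply: DeriveDef; first exact: h1.
  rewrite -derive1E h2; apply: eq_Rintegral => y _.
  by rewrite partial1of2E derive_val.
have mpdf : measurable_fun setT pdf by exact: measurable_normal_pdf.
have ipdf : Rintegrable mu pdf by exact: integrable_normal_pdf.
have icos u : Rintegrable mu (fun y => cos (th + u * y) * pdf y).
  apply: (@Rintegrable_le _ _ _ mu _ _ _ ipdf).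
    by apply: measurable_funM => //; exact: mcos.
  move=> y; rewrite normrM (ger0_norm (normal_pdf_ge0 _ _ _)).
  by rewrite ler_piMl ?normal_pdf_ge0// cos_max.
have iysin u : Rintegrable mu (fun y => y * sin (th + u * y) * pdf y).
  apply: (@Rintegrable_le _ _ _ mu _ _ _ Rintegrable_sqr_normal_pdf).
    by apply: measurable_funM => //; exact: mysin.
  move=> y; rewrite normrM (ger0_norm (normal_pdf_ge0 _ _ _)).
  rewrite ler_wpM2r ?normal_pdf_ge0//.
  by apply: le_trans (norm_le_oneDsqr y); rewrite normrM ler_piMr// sin_max.
have K'E u : \int[N01]_y (- (y * sin (th + u * y))) = - u * K u.
  rewrite Rintegral_normal_prob; first last.
  - under eq_fun do rewrite mulNr -mulN1r.
    by apply: RintegrableZ; exact: iysin.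
  - by apply: measurableT_comp => //; exact: mysin.
  rewrite /K Rintegral_normal_prob//.
  under eq_Rintegral => y _ do rewrite mulNr -mulN1r.
  rewrite RintegralT_Z// mulN1r mulNr -RintegralT_Z//; congr (- _).
  under [in RHS]eq_Rintegral => y _ do rewrite mulrA.
  have i1 : Rintegrable mu (fun y => u * cos (th + u * y) * pdf y).
    rewrite (_ : (fun y => _) = fun y => u * (cos (th + u * y) * pdf y)).
      by apply: RintegrableZ; exact: icos.
    by apply/funext => y; rewrite mulrA.
  apply/esym/eqP; rewrite -subr_eq0; apply/eqP.
  rewrite -[RHS](normal_stein_sin u th).
  exact/esym/(RintegralB measurableT i1 (iysin u)).
pose h u := K u * expR (u ^+ 2 / 2).
have dh u : is_derive u (1 : R) h 0.
  have dKu := dK u; rewrite K'E in dKu.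
  by apply: is_derive_eq; rewrite /GRing.scale/=; field.
have := @is_derive_0_is_cst _ h t 0 dh.
rewrite /h expr0n mul0r expR0 mulr1 {2}/K.
under [in RHS]eq_Rintegral => y _ do rewrite mul0r addr0.
rewrite Rintegral_prob_cst => <-.
by rewrite mulrCA -expRD addNr expR0 mulr1.
Qed.

End standard_normal.

(** * The continuity theorem for a normal limit *)

Section trig_poly_integral.
Context d (T : measurableType d) (R : realType) (P : probability T R).
Implicit Types (Y : T -> R) (h f : R -> R).

Lemma Rintegrable_trig_poly Y h : measurable_fun setT Y -> trig_poly h ->
  Rintegrable P (fun w => h (Y w)).
Proof.
move=> mY; elim=> {h} [a t r|f g _ mf _ mg]; last exact: RintegrableD.
apply: RintegrableZ; apply: (@Rintegrable_bounded _ _ _ _ _ 1).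
  apply: measurableT_comp.
    by apply: continuous_measurable_fun; exact: continuous_cos.
  by apply: measurable_funD => //; exact: measurable_funM.
by move=> w; exact: cos_max.
Qed.

Lemma Rintegral_approx_le Y f h e c : measurable_fun setT Y ->
  Rintegrable P (fun w => 1 + Y w ^+ 2) ->
  Rintegrable P (fun w => f (Y w)) -> Rintegrable P (fun w => h (Y w)) ->
  (forall y, `|f y - h y| <= e + c * (1 + y ^+ 2)) ->
  `|\int[P]_w f (Y w) - \int[P]_w h (Y w)| <=
    e + c * \int[P]_w (1 + Y w ^+ 2).
Proof.
move=> mY iY fi hi H.
rewrite -RintegralB//.
have -> : e + c * \int[P]_w (1 + Y w ^+ 2) =
    \int[P]_w (e + c * (1 + Y w ^+ 2)).
  rewrite (RintegralT_D (Rintegrable_cst P e) (RintegrableZ c iY)).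
  by rewrite Rintegral_prob_cst RintegralT_Z.
apply: le_norm_Rintegral => //.
- exact: Rintegrable_measurable (RintegrableB fi hi).
- by apply: RintegrableD; [exact: Rintegrable_cst|exact: RintegrableZ].
Qed.

End trig_poly_integral.

Section continuity_theorem.
Context d (T : measurableType d) (R : realType) (P : probability T R).
#[local] Notation N01 := (normal_prob (0 : R) 1).
Variables (Y : nat -> T -> R).
Hypothesis mY : forall n, measurable_fun setT (Y n).
Hypothesis Y_cos : forall t th,
  \int[P]_w cos (th + t * Y n w) @[n --> \oo] --> expR (- (t ^+ 2 / 2)) * cos th.

Lemma cvg_Rintegral_trig_poly h : trig_poly h ->
  \int[P]_w h (Y n w) @[n --> \oo] --> \int[N01]_y h y.
Proof.
elim=> {h} [a t r|f g tf Hf tg Hg].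
- have I n : \int[P]_w (a * cos (t * Y n w + r)) =
      a * \int[P]_w cos (r + t * Y n w).
    under eq_Rintegral => w _ do rewrite (addrC _ r).
    have := Rintegrable_trig_poly P (mY n) (trig_poly_cos 1 t r).
    under eq_fun do rewrite mul1r (addrC _ r).
    exact: RintegralT_Z.
  rewrite (funext I).
  have -> : \int[N01]_y (a * cos (t * y + r)) =
      a * (expR (- (t ^+ 2 / 2)) * cos r).
    rewrite -Rintegral_normal_cos.
    under eq_Rintegral => w _ do rewrite (addrC _ r).
    have := Rintegrable_trig_poly N01 (@measurable_id _ _ setT) (trig_poly_cos 1 t r).
    under eq_fun do rewrite mul1r (addrC _ r).
    exact: RintegralT_Z.
  by apply: cvgM; [exact: cvg_cst|exact: Y_cos].
- have I n : \int[P]_w (f (Y n w) + g (Y n w)) =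
      \int[P]_w f (Y n w) + \int[P]_w g (Y n w).
    by apply: RintegralT_D; exact: Rintegrable_trig_poly.
  rewrite (funext I) RintegralT_D; first exact: cvgD.
  + exact: (Rintegrable_trig_poly N01 (@measurable_id _ _ setT) tf).
  + exact: (Rintegrable_trig_poly N01 (@measurable_id _ _ setT) tg).
Qed.

(** The second moments make the laws tight, so that a trigonometric polynomial
    close to [f] on a large segment and bounded by the bound of [f] elsewhere
    has nearly the same integrals as [f]. *)
Theorem cvg_Rintegral_bounded_continuous K f M :
  (\forall n \near \oo, Rintegrable P (fun w => 1 + Y n w ^+ 2) /\
    \int[P]_w (1 + Y n w ^+ 2) <= K) ->
  continuous f -> (forall y, `|f y| <= M) ->
  \int[P]_w f (Y n w) @[n --> \oo] --> \int[N01]_y f y.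
Proof.
move=> Y2 cf bf.
have M0 : 0 <= M by apply: le_trans (bf 0).
have mf : measurable_fun setT f by exact: continuous_measurable_fun.
pose B := `|K| + \int[N01]_y (1 + y ^+ 2).
have N0 : 0 <= \int[N01]_y (1 + y ^+ 2).
  by apply: Rintegral_ge0 => y _; rewrite addr_ge0 ?sqr_ge0.
have B0 : 0 <= B by rewrite addr_ge0.
apply/cvgrPdist_le => e e0; pose u := e / 5; have u0 : 0 < u by rewrite divr_gt0.
(* [c] below is the price of a unit of [1 + y ^+ 2] in the comparison of [f] and
   [h]; [L] makes it so small that it contributes at most [u] in the mean. *)
pose L := 1 + 2 * M * B / u.
have LB : 0 <= 2 * M * B / u by rewrite divr_ge0 ?mulr_ge0// ltW.
have L1 : 1 <= L by rewrite lerDl.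
have L0 : 0 < L by apply: lt_le_trans L1.
have [h [th bh fh]] := trig_poly_approx cf bf L0 u0.
pose c := 2 * M / L ^+ 2.
have c0 : 0 <= c by rewrite divr_ge0 ?sqr_ge0// mulr_ge0.
have cB b : b <= B -> c * b <= u.
  move=> bB; apply: (@le_trans _ _ (c * B)); first by rewrite ler_wpM2l.
  rewrite /c mulrAC ler_pdivrMr ?exprn_gt0//.
  apply: (@le_trans _ _ (u * L)).
    by rewrite /L [leRHS]mulrDr mulr1 [u * (_ / u)]mulrC divfK ?gt_eqF// lerDr ltW.
  by rewrite ler_pM2l// expr2 ler_peMr// ltW.
have fhc y : `|f y - h y| <= u + c * (1 + y ^+ 2).
  have [yL|Ly] := leP `|y| L.
    by rewrite (le_trans (fh y yL))// lerDl mulr_ge0// addr_ge0 ?sqr_ge0.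
  apply: ler_wpDl; first exact: ltW.
  apply: (@le_trans _ _ (2 * M)).
    by rewrite (le_trans (ler_normB _ _))// mulr2n mulrDl mul1r lerD.
  rewrite /c mulrAC ler_pdivlMr ?exprn_gt0// ler_wpM2l ?mulr_ge0//.
  rewrite -(@real_normK _ y) ?num_real//.
  apply: ler_wpDl => //; rewrite lerXn2r ?nnegrE//; exact: ltW.
have HN : `|\int[N01]_y f y - \int[N01]_y h y| <= 2 * u.
  have fi : Rintegrable N01 f by apply: (@Rintegrable_bounded _ _ _ N01 f M).
  have hi := Rintegrable_trig_poly N01 (@measurable_id _ _ setT) th.
  have := @Rintegral_approx_le _ _ _ N01 idfun f h u c (@measurable_id _ _ setT)
    (Rintegrable_normal_sqr R) fi hi fhc.
  move=> /le_trans; apply.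
  by rewrite mulr2n mulrDl mul1r lerD2l; apply: cB; rewrite lerDr.
have HH : \forall n \near \oo,
    `|\int[N01]_y h y - \int[P]_w h (Y n w)| <= u.
  by move/cvgrPdist_le : (cvg_Rintegral_trig_poly th); apply.
near=> n.
have [iYn Yn2] : Rintegrable P (fun w => 1 + Y n w ^+ 2) /\
    \int[P]_w (1 + Y n w ^+ 2) <= K by near: n.
have HP : `|\int[P]_w f (Y n w) - \int[P]_w h (Y n w)| <= 2 * u.
  apply: le_trans (Rintegral_approx_le (mY n) iYn _ _ fhc) _.
  - apply: (@Rintegrable_bounded _ _ _ _ _ M) => //.
    exact: measurableT_comp.
  - exact: Rintegrable_trig_poly.
  - rewrite mulr2n mulrDl mul1r lerD2l; apply: cB.
    by rewrite (le_trans Yn2)// ler_wpDr// ler_norm.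
have HHn : `|\int[N01]_y h y - \int[P]_w h (Y n w)| <= u.
  by near: n.
have eE : e = 5 * u by rewrite /u mulrC divfK.
have -> : e = 2 * u + u + 2 * u by rewrite eE; ring.
move: HN HP HHn.
set a := \int[N01]_y f y; set b := \int[N01]_y h y.
set a' := \int[P]_w f _; set b' := \int[P]_w h _ => h1 h2 h3.
rewrite (_ : a - a' = (a - b) + (b - b') - (a' - b')); last by ring.
rewrite (le_trans (ler_normB _ _))// lerD// (le_trans (ler_normD _ _))//.
by rewrite lerD.
Unshelve. all: by end_near. Qed.

End continuity_theorem.

(** * One block of independent variables *)

Lemma measurable_tail (R : realType) (e : R) : measurable [set x : R | e <= `|x|].
Proof.
rewrite (_ : [set x | _] = setT `&` (@Num.norm R R) @^-1` `[e, +oo[%classic).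
  have mn : measurable_fun [set: R] (@Num.norm R R) by exact: normr_measurable.
  exact: mn.
by rewrite setTI; apply/seteqP; split => x; rewrite /= in_itv/= andbT.
Qed.

Section block.
Context d (T : measurableType d) (R : realType) (P : probability T R).
Variables (X : nat -> {RV P >-> R}) (D : set nat) (a : nat).
Hypothesis indepX : independent_RVs D X.
Hypothesis aD : forall k, (a <= k)%N -> D k.
Hypothesis iX2 : forall k, (a <= k)%N -> Rintegrable P (fun w => X k w ^+ 2).
Hypothesis cX : forall k, (a <= k)%N -> \int[P]_w X k w = 0.
Implicit Types (t e u r th : R).

Definition moment2 k : R := \int[P]_w (X k w ^+ 2).

Definition tail_moment2 e k : R :=
  \int[P]_w (X k w ^+ 2 *+ (e <= `|X k w|)%R).

Definition mean_cos t k : R := \int[P]_w cos (t * X k w).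

Definition mean_sin t k : R := \int[P]_w sin (t * X k w).

Let S := partial_sum X a.

Let measurable_scaled t k : measurable_fun setT (fun w => t * X k w).
Proof. exact: measurable_funM. Qed.

Let iX k : (a <= k)%N -> Rintegrable P (X k).
Proof.
move=> ak; apply: (@Rintegrable_le _ _ _ P _ (fun w => 1 + X k w ^+ 2)) => //.
  by apply: RintegrableD; [exact: Rintegrable_cst|exact: iX2].
by move=> w; exact: norm_le_oneDsqr.
Qed.

Let icos t k : Rintegrable P (fun w => cos (t * X k w)).
Proof.
apply: (@Rintegrable_bounded _ _ _ _ _ 1) => [|w]; last exact: cos_max.
apply: measurableT_comp (measurable_scaled t k).
by apply: continuous_measurable_fun; exact: continuous_cos.
Qed.

Let isin t k : Rintegrable P (fun w => sin (t * X k w)).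
Proof.
apply: (@Rintegrable_bounded _ _ _ _ _ 1) => [|w]; last exact: sin_max.
apply: measurableT_comp (measurable_scaled t k).
by apply: continuous_measurable_fun; exact: continuous_sin.
Qed.

Lemma Rintegrable_tail e k : (a <= k)%N ->
  Rintegrable P (fun w => X k w ^+ 2 *+ (e <= `|X k w|)%R).
Proof.
move=> ak; apply: (@Rintegrable_le _ _ _ P _ (fun w => X k w ^+ 2)).
- rewrite (_ : (fun w => _) =
    (fun w => X k w ^+ 2 * \1_[set x : R | e <= `|x|] (X k w))); last first.
    apply/funext => w; rewrite indicE.
    have -> : (X k w \in [set x : R | e <= `|x|]) = (e <= `|X k w|).
      by apply/idP/idP; rewrite inE.
    by case: (e <= _); rewrite ?mulr1 ?mulr0.
  apply: measurable_funM; first exact: measurable_funX.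
  apply: measurableT_comp => //; apply: measurable_indic.
  exact: measurable_tail.
- exact: iX2.
- by move=> w; case: (e <= _); rewrite ?mulr1n ?mulr0n ger0_norm ?sqr_ge0.
Qed.

Lemma moment2_ge0 k : 0 <= moment2 k.
Proof. by apply: Rintegral_ge0 => w _; exact: sqr_ge0. Qed.

Lemma tail_moment2_ge0 e k : 0 <= tail_moment2 e k.
Proof. by apply: Rintegral_ge0 => w _; rewrite mulrn_wge0// sqr_ge0. Qed.

Lemma moment2_le e k : (a <= k)%N -> 0 <= e ->
  moment2 k <= e ^+ 2 + tail_moment2 e k.
Proof.
move=> ak e0; rewrite -[e ^+ 2](Rintegral_prob_cst P) -RintegralT_D; last 2 first.
- exact: Rintegrable_cst.
- exact: Rintegrable_tail.
apply: le_RintegralT; first exact: iX2.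
  by apply: RintegrableD; [exact: Rintegrable_cst|exact: Rintegrable_tail].
move=> w; have [ex|xe] := leP e `|X k w|; first by rewrite lerDr sqr_ge0.
rewrite addr0 -(@real_normK _ (X k w)) ?num_real//.
by rewrite lerXn2r ?nnegrE// ltW.
Qed.

Lemma mean_cos_le1 t k : mean_cos t k <= 1.
Proof.
rewrite -(Rintegral_prob_cst P 1); apply: le_RintegralT => //.
exact: Rintegrable_cst.
Qed.

Lemma mean_cos_ge t k : (a <= k)%N ->
  1 - mean_cos t k <= t ^+ 2 * moment2 k / 2.
Proof.
move=> ak.
have -> : 1 - mean_cos t k = \int[P]_w (1 - cos (t * X k w)).
  rewrite (RintegralB measurableT (Rintegrable_cst P 1) (icos t k)).
  by rewrite Rintegral_prob_cst.
rewrite mulrAC -RintegralT_Z; last exact: iX2.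
apply: le_RintegralT.
- by apply: RintegrableB => //; exact: Rintegrable_cst.
- by apply: RintegrableZ; exact: iX2.
- move=> w /=; set y := X k w; have := cos_ge_sqr (t * y); rewrite exprMn; lra.
Qed.

Let remainder t e k := `|t| ^+ 3 * e * moment2 k + t ^+ 2 * tail_moment2 e k.

Let remainderE t e k : (a <= k)%N ->
  Rintegrable P (fun w => `|t| ^+ 3 * e * X k w ^+ 2 +
                 t ^+ 2 * (X k w ^+ 2 *+ (e <= `|X k w|)%R)) /\
  \int[P]_w (`|t| ^+ 3 * e * X k w ^+ 2 +
                 t ^+ 2 * (X k w ^+ 2 *+ (e <= `|X k w|)%R)) = remainder t e k.
Proof.
move=> ak; have h1 := RintegrableZ (`|t| ^+ 3 * e) (iX2 ak).
have h2 := RintegrableZ (t ^+ 2) (Rintegrable_tail e ak).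
split; first exact: RintegrableD.
by rewrite (RintegralT_D h1 h2) !RintegralT_Z//; [exact: Rintegrable_tail|exact: iX2].
Qed.

Lemma mean_cos_remainder t e k : (a <= k)%N -> 0 < e ->
  `|mean_cos t k - (1 - t ^+ 2 * moment2 k / 2)| <= remainder t e k.
Proof.
move=> ak e0; have [ir rE] := remainderE t e ak.
have i2 := RintegrableZ (t ^+ 2 / 2) (iX2 ak).
have i3 := RintegrableB (Rintegrable_cst P 1) i2.
have -> : 1 - t ^+ 2 * moment2 k / 2 = \int[P]_w (1 - t ^+ 2 / 2 * X k w ^+ 2).
  rewrite (RintegralB measurableT (Rintegrable_cst P 1) i2) Rintegral_prob_cst.
  rewrite RintegralT_Z; last exact: iX2.
  by rewrite -/(moment2 k) [t ^+ 2 * _ / _]mulrAC.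
rewrite -(RintegralB measurableT (icos t k) i3) -rE; apply: le_norm_Rintegral => //.
  exact: Rintegrable_measurable (RintegrableB (icos t k) i3).
by move=> w; rewrite [t ^+ 2 / 2 * _]mulrAC; exact: cos_remainder.
Qed.

Lemma mean_sin_remainder t e k : (a <= k)%N -> 0 < e ->
  `|mean_sin t k| <= remainder t e k.
Proof.
move=> ak e0; have [ir rE] := remainderE t e ak.
have i2 := RintegrableZ t (iX ak).
have -> : mean_sin t k = \int[P]_w (sin (t * X k w) - t * X k w).
  rewrite (RintegralB measurableT (isin t k) i2) RintegralT_Z; last exact: iX.
  by rewrite cX// mulr0 subr0.
rewrite -rE; apply: le_norm_Rintegral => //.
  exact: Rintegrable_measurable (RintegrableB (isin t k) i2).
by move=> w; exact: sin_remainder.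
Qed.

Let C t m th := \int[P]_w cos (th + t * S m w).

Let CS t m th : C t m.+1 th =
  C t m th * mean_cos t (a + m) + C t m (th + pi / 2) * mean_sin t (a + m).
Proof. exact: (Rintegral_cos_sumS indepX aD t m th). Qed.

Let C0 t th : C t 0 th = cos th.
Proof.
rewrite /C -[RHS](Rintegral_prob_cst P); apply: eq_Rintegral => w _.
by rewrite /S /partial_sum addn0 big_geq// mulr0 addr0.
Qed.

Let C_le1 t m th : `|C t m th| <= 1.
Proof.
rewrite -[leRHS](Rintegral_prob_cst P); apply: le_norm_Rintegral.
- apply: measurableT_comp.
    by apply: continuous_measurable_fun; exact: continuous_cos.
  apply: measurable_funD => //; apply: measurable_funM => //.
  exact: measurable_partial_sum.
- exact: Rintegrable_cst.
- by move=> w; exact: cos_max.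
Qed.

(** Each step multiplies the mean of the cosine by the factor [mean_cos] up to
    the error [mean_sin]; since the means never exceed 1, replacing the factors
    by the numbers [w k] costs at most the sum of the differences. *)
Lemma mean_cos_partial_sum_approx t m th (w : nat -> R) :
  (forall k, 0 <= w k <= 1) ->
  `|\int[P]_x cos (th + t * partial_sum X a m x) -
      (\prod_(a <= k < a + m) w k) * cos th| <=
  \sum_(a <= k < a + m) (`|mean_cos t k - w k| + `|mean_sin t k|).
Proof.
move=> w01; rewrite -/S -/(C t m th); elim: m => [|m IH].
  by rewrite addn0 !big_geq// C0 mul1r subrr normr0.
rewrite addnS !big_nat_recr ?leq_addr//= CS.
set c := mean_cos t _; set s := mean_sin t _; set W := \prod_(_ <= _ < _) _.
set wm := w (a + m)%N; have /andP[w0 w1] := w01 (a + m)%N.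
have -> : C t m th * c + C t m (th + pi / 2) * s - W * wm * cos th =
    wm * (C t m th - W * cos th) +
    (C t m th * (c - wm) + C t m (th + pi / 2) * s) by ring.
apply: (le_trans (ler_normD _ _)); apply: lerD.
  rewrite normrM ger0_norm//; apply: le_trans IH.
  by rewrite ler_piMl.
apply: (le_trans (ler_normD _ _)); rewrite !normrM.
by apply: lerD; rewrite ler_piMl.
Qed.

Let C_pi t m th : C t m (th + pi / 2 + pi / 2) = - C t m th.
Proof.
rewrite /C -mulN1r -RintegralT_Z.
  apply: eq_Rintegral => w _.
  by rewrite mulN1r (addrAC _ (pi / 2)) cosDpihalf addrAC sinDpihalf.
apply: (@Rintegrable_bounded _ _ _ _ _ 1) => [|w]; last exact: cos_max.
apply: measurableT_comp.
  by apply: continuous_measurable_fun; exact: continuous_cos.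
apply: measurable_funD => //; apply: measurable_funM => //.
exact: measurable_partial_sum.
Qed.

(** The squared modulus of a characteristic function is multiplicative, and is
    at least the square of the real part. *)
Lemma prod_mean_cos_le t m :
  \prod_(a <= k < a + m) mean_cos t k ^+ 2 <=
  (\int[P]_x cos (0 + t * partial_sum X a m x)) ^+ 2 +
  (\int[P]_x cos (pi / 2 + t * partial_sum X a m x)) ^+ 2.
Proof.
rewrite -/S -[in leRHS](add0r (pi / 2)) -/(C t m 0) -/(C t m (0 + pi / 2)).
elim: m => [|m IH].
  by rewrite addn0 big_geq// !C0 cosDpihalf sqrrN cos2Dsin2.
rewrite addnS big_nat_recr ?leq_addr//= !CS C_pi.
set c := mean_cos t _; set s := mean_sin t _.
set A := C t m 0; set B := C t m _.
have -> : (A * c + B * s) ^+ 2 + (B * c + - A * s) ^+ 2 =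
    (A ^+ 2 + B ^+ 2) * c ^+ 2 + (A ^+ 2 + B ^+ 2) * s ^+ 2 by ring.
apply: ler_wpDr; first by rewrite mulr_ge0 ?addr_ge0 ?sqr_ge0.
by rewrite ler_wpM2r ?sqr_ge0.
Qed.

Lemma expR_le_prod_mean_cos t m r : r < 1 ->
  (forall k, (a <= k < a + m)%N -> 1 - mean_cos t k <= r) ->
  expR (- (2 * (\sum_(a <= k < a + m) (1 - mean_cos t k)) / (1 - r))) <=
  \prod_(a <= k < a + m) mean_cos t k ^+ 2.
Proof.
move=> r1; elim: m => [|m IH] H.
  by rewrite addn0 !big_geq// mulr0 mul0r oppr0 expR0.
rewrite addnS !big_nat_recr ?leq_addr//= mulrDr mulrDl opprD expRD.
apply: ler_pM; rewrite ?expR_ge0//.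
  by apply: IH => k /andP[ak km]; apply: H; rewrite ak addnS ltnW.
have := H (a + m)%N; rewrite leq_addr addnS leqnn => /(_ isT).
set c := mean_cos t _ => cr; have c1 : c <= 1 by exact: mean_cos_le1.
have c0 : 0 < c by lra.
have -> : - (2 * (1 - c) / (1 - r)) = 2%:R * - ((1 - c) / (1 - r)) by ring.
rewrite expRM_natl; apply: lerXn2r; rewrite ?nnegrE ?expR_ge0 ?(ltW c0)//.
apply: le_trans (expR_le_of_gt0 c0); rewrite ler_expR lerN2.
by rewrite ler_wpM2l ?subr_ge0// lef_pV2 ?posrE//; lra.
Qed.

(** The integrand [(t * x) ^+ 2 / 2 - 1 + cos (t * x)] is nonnegative, and on
    the tail the quadratic term dominates the bounded ones. *)
Lemma tail_moment2_le t e k : (a <= k)%N -> 0 < e ->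
  (t ^+ 2 / 2 - 2 / e ^+ 2) * tail_moment2 e k <=
  t ^+ 2 * moment2 k / 2 - (1 - mean_cos t k).
Proof.
move=> ak e0; rewrite -RintegralT_Z; last exact: Rintegrable_tail.
have i2 := RintegrableZ (t ^+ 2 / 2) (iX2 ak).
have i3 := RintegrableB (Rintegrable_cst P 1) (icos t k).
have -> : t ^+ 2 * moment2 k / 2 - (1 - mean_cos t k) =
    \int[P]_w (t ^+ 2 / 2 * X k w ^+ 2 - (1 - cos (t * X k w))).
  rewrite (RintegralB measurableT i2 i3).
  rewrite (RintegralB measurableT (Rintegrable_cst P 1) (icos t k)).
  rewrite Rintegral_prob_cst RintegralT_Z; last exact: iX2.
  by rewrite -/(moment2 k) -/(mean_cos t k) [t ^+ 2 * _ / _]mulrAC.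
apply: le_RintegralT; first by apply: RintegrableZ; exact: Rintegrable_tail.
  exact: RintegrableB.
move=> w; set x := X k w.
have := cos_ge_sqr (t * x); have := cos_geN1 (t * x); rewrite exprMn.
have [ex|xe] := leP e `|x|; rewrite ?mulr1n ?mulr0n ?mulr0; last by lra.
have : 2 <= 2 / e ^+ 2 * x ^+ 2.
  rewrite mulrAC -mulrA ler_peMr// ler_pdivlMr ?exprn_gt0// mul1r.
  by rewrite -(@real_normK _ x) ?num_real// lerXn2r ?nnegrE// ltW.
by lra.
Qed.

Lemma mean_sin_le t k : (a <= k)%N -> `|mean_sin t k| <= 2 * t ^+ 2 * moment2 k.
Proof.
move=> ak.
(* With [e = (1 + `|t|)^-1] the cubic term [`|t| ^+ 3 * e] is at most
   [t ^+ 2]. *)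
have t1 : 0 < 1 + `|t| by rewrite ltr_pwDl.
apply: le_trans (mean_sin_remainder t ak (_ : 0 < (1 + `|t|)^-1)) _.
  by rewrite invr_gt0.
have h1 : tail_moment2 (1 + `|t|)^-1 k <= moment2 k.
  apply: le_RintegralT; [exact: Rintegrable_tail|exact: iX2|move=> w].
  by case: (_^-1 <= _); rewrite ?mulr1n ?mulr0n ?sqr_ge0.
have h2 : `|t| ^+ 3 / (1 + `|t|) <= t ^+ 2.
  rewrite ler_pdivrMr// exprSr real_normK ?num_real// ler_wpM2l ?sqr_ge0//.
  by rewrite lerDr.
have -> : 2 * t ^+ 2 * moment2 k = t ^+ 2 * moment2 k + t ^+ 2 * moment2 k.
  by ring.
apply: lerD.
  by rewrite ler_wpM2r ?moment2_ge0.
by rewrite ler_wpM2l ?sqr_ge0.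
Qed.

(** The square is compared with [1 - cos] near the origin, whose mean is
    controlled by the characteristic function; this spares the orthogonality of
    the variables, and any constant is enough to get tightness. *)
Lemma moment2_partial_sum m :
  Rintegrable P (fun w => partial_sum X a m w ^+ 2) /\
  \int[P]_w (partial_sum X a m w ^+ 2) <= 8 * \sum_(a <= k < a + m) moment2 k.
Proof.
rewrite -/S; have mS : measurable_fun setT (S m) by exact: measurable_partial_sum.
have iS2 : Rintegrable P (fun w => S m w ^+ 2).
  elim: m {mS} => [|m IH].
    rewrite (_ : (fun w => _) = fun=> 0); first exact: Rintegrable_cst.
    by apply/funext => w; rewrite /S /partial_sum addn0 big_geq// expr0n.
  apply: (@Rintegrable_le _ _ _ P _
    (fun w => 2 * S m w ^+ 2 + 2 * X (a + m)%N w ^+ 2)).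
  - by apply: measurable_funX; exact: measurable_partial_sum.
  - by apply: RintegrableD; apply: RintegrableZ => //; apply: iX2; exact: leq_addr.
  - move=> w; rewrite /S partial_sumS ger0_norm ?sqr_ge0//.
    have := sqr_ge0 (partial_sum X a m w - X (a + m)%N w).
    by lra.
split=> //; set V := \sum_(_ <= _ < _) _.
have V0 : 0 <= V by apply: sumr_ge0 => k _; exact: moment2_ge0.
have icosS t : Rintegrable P (fun w => cos (t * S m w)).
  apply: (@Rintegrable_bounded _ _ _ _ _ 1) => [|w]; last exact: cos_max.
  apply: measurableT_comp; last exact: measurable_funM.
  by apply: continuous_measurable_fun; exact: continuous_cos.
have near0 t : \int[P]_w (1 - cos (t * S m w)) <= 5 / 2 * t ^+ 2 * V.
  rewrite (RintegralB measurableT (Rintegrable_cst P 1) (icosS t)).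
  rewrite Rintegral_prob_cst.
  have w01 : forall k : nat, 0 <= (fun=> 1 : R) k <= 1.
    by move=> k; rewrite ler01 lexx.
  have := @mean_cos_partial_sum_approx t m 0 _ w01 => {w01}.
  under eq_Rintegral => w _ do rewrite add0r.
  rewrite big1 ?cos0 ?mulr1// distrC => /(le_trans (ler_norm _)) /le_trans; apply.
  rewrite /V mulr_sumr; apply: ler_sum_nat => k /andP[ak _].
  have -> : `|mean_cos t k - 1| = 1 - mean_cos t k.
    by rewrite distrC ger0_norm// subr_ge0 mean_cos_le1.
  by have := mean_sin_le t ak; have := mean_cos_ge t ak; lra.
pose f_ n w : R := S m w ^+ 2 *+ (`|S m w| <= n.+1%:R)%R.
have f_le n w : 0 <= f_ n w <= S m w ^+ 2.
  by rewrite /f_; case: (`|_| <= _); rewrite ?mulr1n ?mulr0n ?lexx sqr_ge0.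
have mf n : measurable_fun setT (f_ n).
  rewrite (_ : f_ n = fun w => S m w ^+ 2 *
      \1_`[- n.+1%:R, n.+1%:R]%classic (S m w)); last first.
    apply/funext => w; rewrite indicE mem_setE in_itv/= -ler_norml /f_.
    by case: (`|_| <= _); rewrite ?mulr1 ?mulr0.
  apply: measurable_funM; first exact: measurable_funX.
  by apply: measurableT_comp => //; apply: measurable_indic.
have L : \int[P]_w f_ n w @[n --> \oo] --> \int[P]_w (S m w ^+ 2).
  apply: (@Rintegral_dominated_cvg _ _ _ P _ _ (fun w => S m w ^+ 2)) => //.
  - exact: measurable_funX.
  - by move=> n w; case/andP: (f_le n w) => h1 h2; rewrite ger0_norm.
  - move=> w; apply: cvg_near_cst; near=> n; rewrite /f_.
    suff -> : (`|S m w| <= n.+1%:R) by [].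
    near: n; exists (Num.bound `|S m w|) => //= n /= yn.
    apply: (le_trans (ltW (archi_boundP (normr_ge0 _)))).
    by rewrite ler_nat ltnW.
have le8 n : \int[P]_w f_ n w <= 8 * V.
  set N := n.+1%:R : R; have N0 : 0 < N by rewrite ltr0n.
  have i1 := RintegrableB (Rintegrable_cst P 1) (icosS N^-1).
  apply: (@le_trans _ _ (\int[P]_w (3 * N ^+ 2 * (1 - cos (N^-1 * S m w))))).
    apply: le_RintegralT.
    - apply: (@Rintegrable_le _ _ _ P _ _ (mf n) iS2) => w.
      by case/andP: (f_le n w) => h1 h2; rewrite ger0_norm.
    - exact: RintegrableZ.
    - move=> w; rewrite /f_ -/N; have [SN|_] := leP `|S m w| N; last first.
        by rewrite mulr0n mulr_ge0 ?subr_ge0 ?cos_le1// mulr_ge0 ?sqr_ge0.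
      have := one_sub_cos_ge (_ : `|N^-1 * S m w| <= 1).
      rewrite normrM gtr0_norm ?invr_gt0// ler_pdivrMl// mulr1 => /(_ SN).
      rewrite exprMn exprVn mulr1n => h.
      rewrite -mulrA -ler_pdivrMl// mulrC -ler_pdivrMl ?exprn_gt0//.
      by rewrite mulrA.
  rewrite RintegralT_Z//; apply: (le_trans (ler_wpM2l _ (near0 _))).
    by rewrite mulr_ge0 ?sqr_ge0.
  have -> : 3 * N ^+ 2 * (5 / 2 * N^-1 ^+ 2 * V) = 15 / 2 * V.
    by field; exact: lt0r_neq0.
  lra.
rewrite -(cvg_lim _ L)//; apply: limr_le; last exact: nearW.
by apply/cvg_ex; exists (\int[P]_w (S m w ^+ 2)).
Unshelve. all: by end_near. Qed.

End block.

(** * Integrals against a distribution function *)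

Section stieltjes.
Context d (T : measurableType d) (R : realType) (P : probability T R).
Variable X : {RV P >-> R}.

(** The Stieltjes measure lives on [measurableTypeR R], that is [R] with its
    Borel sets under another display, and so must the law of [X]. *)
Let XR : T -> measurableTypeR R := X.

Let measurable_XR : measurable_fun [set: T] XR.
Proof. by move=> mT B mB; rewrite setTI; exact: (measurable_funPTI X). Qed.

#[local] HB.instance Definition _ :=
  @isMeasurableFun.Build _ _ _ _ XR measurable_XR.

Lemma lebesgue_stieltjes_distr_fun (A : set (measurableTypeR R)) :
  measurable A ->
  lebesgue_stieltjes_measure (distr_fun X) A =
  distribution P (XR : {mfun T >-> measurableTypeR R}) A.
Proof.
move=> mA; apply: lebesgue_stieltjes_measure_unique => [I [[a b]]/= _ <-|//].
rewrite /lebesgue_stieltjes_measure /measure_extension/=.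
rewrite measurable_mu_extE/=; last exact: is_ocitv.
have [ab|ba] := leP a b; last first.
  by rewrite set_itv_ge ?wlength0 ?measure0// bnd_simp -leNgt ltW.
rewrite wlength_itv_bnd// EFinB /distr_fun !fineK ?fin_num_measure//.
rewrite /cdf /distribution /pushforward /XR.
have -> : `]a, b]%classic = `]-oo, b] `\` `]-oo, a].
  by rewrite -[RHS]setCK setCD setCitvl setUC -[LHS]setCK setCitv.
have mX (B : set R) : measurable B -> measurable (X @^-1` B).
  by move=> mB; exact: measurable_funPTI.
rewrite (_ : X @^-1` (`]-oo, b] `\` `]-oo, a]) =
  X @^-1` `]-oo, b] `\` X @^-1` `]-oo, a])//.
rewrite measureD; last 3 first.
- exact: mX.
- exact: mX.
- by rewrite -ge0_fin_numE// fin_num_measure//; exact: mX.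
by rewrite setIidr// => w /=; rewrite !in_itv/= => /le_trans; exact.
Qed.

Lemma ge0_integral_distr_fun (f : R -> R) (D : set R) :
  measurable_fun [set: R] f -> (forall x, 0 <= f x) -> measurable D ->
  (\int[lebesgue_stieltjes_measure (distr_fun X)]_(x in D) (f x)%:E =
   \int[P]_(w in X @^-1` D) (f (X w))%:E)%E.
Proof.
move=> mf f0 mD.
rewrite (eq_measure_integral
  (distribution P (XR : {mfun T >-> measurableTypeR R}))); last first.
  by move=> A mA _; exact: lebesgue_stieltjes_distr_fun.
rewrite /distribution ge0_integral_pushforward//.
- by apply/measurable_EFinP; apply: measurable_funTS.
- by move=> y _; rewrite lee_fin.
Qed.

End stieltjes.

(** * Lindeberg's condition and the central limit theorem *)

Section lindeberg_feller.
Context d (T : measurableType d) (R : realType) (P : probability T R).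
Variables (X : nat -> {RV P >-> R}) (p : nat -> nat).
Hypothesis X_indep : independent_RVs [set k | (1 <= k)%N] X.
Hypothesis X_L2 : forall k, (1 <= k)%N -> (X k : T -> R) \in Lfun P 2%:E.
Hypothesis X_centered : forall k, (1 <= k)%N -> ('E_P[X k] = 0)%E.
Hypothesis s'_gt0 : forall n, (1 <= n)%N -> 0 < s' X p n.
Implicit Types (eps t th : R) (n k : nat).

Let a n := (p n).+1.
Let s n := s' X p n.

Let blockE n : (n + p n).+1 = (a n + n)%N.
Proof. by rewrite /a addSn addnC. Qed.

Let a_gt0 n k : (a n <= k)%N -> [set k | (1 <= k)%N] k.
Proof. by move=> h /=; apply: leq_trans h. Qed.

Let iX2 n k : (a n <= k)%N -> Rintegrable P (fun w => X k w ^+ 2).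
Proof. by move=> /a_gt0 k0; exact/Lfun2_integrable_sqr/X_L2. Qed.

Let cX n k : (a n <= k)%N -> \int[P]_w X k w = 0.
Proof.
by move=> /a_gt0 k0; have := X_centered k0; rewrite unlock /Rintegral => ->.
Qed.

Let sqr_sigma k : sigma X k ^+ 2 = moment2 X k.
Proof.
rewrite /sigma unlock sqr_sqrtr//.
by apply: fine_ge0; apply: integral_ge0 => w _; rewrite lee_fin sqr_ge0.
Qed.

Let sqr_s n : s n ^+ 2 = \sum_(a n <= k < a n + n) moment2 X k.
Proof.
rewrite /s /s' sqr_sqrtr; last by apply: sumr_ge0 => k _; exact: sqr_ge0.
by rewrite blockE; apply: eq_bigr => k _; exact: sqr_sigma.
Qed.

Let normalizedE n w :
  normalized_S' X p n w = (s n)^-1 * partial_sum X (a n) n w.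
Proof.
rewrite -[LHS]/((s n)^-1 * (\sum_((p n).+1 <= k < (n + p n).+1)
  (X k : {mfun T >-> R})) w).
by rewrite mfun_sum blockE.
Qed.

Definition lindeberg_sum n eps : R :=
  (s n ^+ 2)^-1 * \sum_(a n <= k < a n + n) tail_moment2 X (eps * s n) k.

Let gE n eps : g X p n eps = (lindeberg_sum n eps)%:E.
Proof.
rewrite /g /lindeberg_sum EFinM -/(s n) blockE -sumEFin; congr (_ * _)%E.
rewrite big_nat [RHS]big_nat; apply: eq_bigr => k /andP[ak _].
have mt := @measurable_tail R (eps * s n).
have msqr : measurable_fun [set: R] (fun x : R => x ^+ 2) by exact: measurable_funX.
rewrite (ge0_integral_distr_fun (X k) msqr (fun x => sqr_ge0 x) mt).
have E w : ((fun w => (X k w ^+ 2)%:E) \_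
      (X k @^-1` [set x : R | eps * s n <= `|x|])) w =
    (X k w ^+ 2 *+ (eps * s n <= `|X k w|)%R)%:E.
  rewrite patchE.
  have -> : (w \in X k @^-1` [set x : R | eps * s n <= `|x|]) =
      (eps * s n <= `|X k w|) by apply/idP/idP; rewrite inE.
  by case: (eps * s n <= _).
rewrite integral_mkcond /tail_moment2 /Rintegral.
under eq_integral => w _ do rewrite E.
rewrite fineK//; apply: integrable_fin_num => //.
exact: (Rintegrable_tail (@iX2 n) (eps * s n) ak).
Qed.

Lemma lindeberg_sum_ge0 n eps : 0 <= lindeberg_sum n eps.
Proof.
rewrite mulr_ge0 ?invr_ge0 ?sqr_ge0//; apply: sumr_ge0 => k _.
exact: tail_moment2_ge0.
Qed.

Lemma cvg_lindeberg_sum eps :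
  g X p n eps @[n --> \oo] --> 0%E <->
  lindeberg_sum n eps @[n --> \oo] --> 0.
Proof.
rewrite (funext (fun n => gE n eps)); split; first by move/fine_cvgP => [].
by move=> H; apply: cvg_EFin => //; exact: nearW.
Qed.

Lemma sigma_ratio_le n k : (a n <= k < a n + n)%N ->
  moment2 X k / s n ^+ 2 <= max_ratio X p n.
Proof.
move=> kn; rewrite -sqr_sigma -exprVn -exprMn /max_ratio blockE.
apply: (@Order.TotalTheory.le_bigmax_seq _ _ _ _ _ k xpredT) => //.
by rewrite mem_index_iota.
Qed.

Lemma max_ratio_ge0 n : 0 <= max_ratio X p n.
Proof. exact: Order.TotalTheory.bigmax_ge_id. Qed.

(** A variance is at most the square of the truncation level plus the second
    moment beyond it. *)
Lemma max_ratio_le n eps : (1 <= n)%N -> 0 < eps ->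
  max_ratio X p n <= eps ^+ 2 + lindeberg_sum n eps.
Proof.
move=> n1 e0; have sn0 := s'_gt0 n1; rewrite -/(s n) in sn0.
rewrite /max_ratio blockE big_seq; apply: bigmax_le.
  by rewrite addr_ge0 ?sqr_ge0 ?lindeberg_sum_ge0.
move=> k; rewrite mem_index_iota => kn; case/andP: (kn) => ak _.
rewrite exprMn exprVn sqr_sigma ler_pdivrMr ?exprn_gt0// mulrDl -exprMn.
apply: (le_trans (moment2_le (@iX2 n) ak (_ : 0 <= eps * s n))).
  by rewrite mulr_ge0 ?ltW.
rewrite lerD2l /lindeberg_sum mulrAC mulVf ?mul1r; last first.
  by rewrite expf_neq0// gt_eqF.
rewrite (big_rem k)/= ?mem_index_iota// lerDl; apply: sumr_ge0 => i _.
exact: tail_moment2_ge0.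
Qed.

Let cos_scale t th n : \int[P]_w cos (th + t * normalized_S' X p n w) =
  \int[P]_w cos (th + t / s n * partial_sum X (a n) n w).
Proof. by apply: eq_Rintegral => w _; rewrite normalizedE mulrA. Qed.

(** The factors [expR (- (t ^+ 2 / 2 * (sigma k / s n) ^+ 2))] multiply to
    [expR (- (t ^+ 2 / 2))] as the variances add up to [s n ^+ 2]. *)
Lemma lindeberg_bound n eps t th : (1 <= n)%N -> 0 < eps ->
  `|\int[P]_w cos (th + t * normalized_S' X p n w) -
      expR (- (t ^+ 2 / 2)) * cos th| <=
  2 * `|t| ^+ 3 * eps + 2 * t ^+ 2 * lindeberg_sum n eps +
    t ^+ 4 / 4 * max_ratio X p n.
Proof.
move=> n1 e0; have sn0 := s'_gt0 n1; rewrite -/(s n) in sn0.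
have sne : s n != 0 by rewrite gt_eqF.
pose v k := moment2 X k / s n ^+ 2.
have v0 k : 0 <= v k by rewrite divr_ge0 ?moment2_ge0 ?sqr_ge0.
have vE k : (t / s n) ^+ 2 * moment2 X k / 2 = t ^+ 2 / 2 * v k.
  by rewrite /v; field.
have sumv : \sum_(a n <= k < a n + n) v k = 1.
  by rewrite -mulr_suml -sqr_s mulfV// expf_neq0.
pose w k := expR (- (t ^+ 2 / 2 * v k)).
have w01 k : 0 <= w k <= 1.
  rewrite expR_ge0 /= -expR0 ler_expR oppr_le0 mulr_ge0//.
  by rewrite divr_ge0 ?sqr_ge0.
have prodw : \prod_(a n <= k < a n + n) w k = expR (- (t ^+ 2 / 2)).
  rewrite -expR_sum; congr expR.
  by rewrite sumrN -mulr_sumr sumv mulr1.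
rewrite cos_scale -prodw.
have := mean_cos_partial_sum_approx X_indep (@a_gt0 n) (t / s n) n th w01.
move=> /le_trans; apply.
pose r k := `|t / s n| ^+ 3 * (eps * s n) * moment2 X k +
  (t / s n) ^+ 2 * tail_moment2 X (eps * s n) k.
have es0 : 0 < eps * s n by rewrite mulr_gt0.
apply: (@le_trans _ _ (\sum_(a n <= k < a n + n)
    (2 * r k + t ^+ 4 / 4 * max_ratio X p n * v k))).
  apply: ler_sum_nat => k kn; case/andP: (kn) => ak _.
  have h1 := mean_cos_remainder (@iX2 n) (t / s n) ak es0.
  have h2 := mean_sin_remainder (@iX2 n) (@cX n) (t / s n) ak es0.
  have u0 : 0 <= t ^+ 2 / 2 * v k by rewrite mulr_ge0// divr_ge0 ?sqr_ge0.
  have h3 := expR_remainder u0.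
  have h4 : (t ^+ 2 / 2 * v k) ^+ 2 <= t ^+ 4 / 4 * max_ratio X p n * v k.
    have -> : (t ^+ 2 / 2 * v k) ^+ 2 = t ^+ 4 / 4 * v k * v k by field.
    rewrite ler_wpM2r// ler_wpM2l ?sigma_ratio_le//.
    by rewrite divr_ge0// exprn_even_ge0.
  rewrite -/(w k) in h3; rewrite vE -/(r k) in h1; rewrite -/(r k) in h2.
  have h5 := ler_distD (1 - t ^+ 2 / 2 * v k) (mean_cos X (t / s n) k) (w k).
  rewrite (distrC (1 - _) (w k)) in h5.
  apply: (le_trans (lerD (le_trans h5 (lerD h1 (le_trans h3 h4))) h2)).
  by rewrite mulr2n mulrDl mul1r addrAC.
rewrite big_split/= -!mulr_sumr sumv mulr1 lerD2r /r big_split/= -!mulr_sumr.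
rewrite -sqr_s mulrDr lerD// le_eqVlt; apply/orP; left; apply/eqP.
  by rewrite normrM normfV (gtr0_norm sn0); field.
by rewrite /lindeberg_sum; field.
Qed.

Let Y n w := normalized_S' X p n w.

Let measurable_Y n : measurable_fun setT (Y n).
Proof. by []. Qed.

Lemma moment2_normalized n : (1 <= n)%N ->
  Rintegrable P (fun w => 1 + Y n w ^+ 2) /\ \int[P]_w (1 + Y n w ^+ 2) <= 9.
Proof.
move=> n1; have sn0 := s'_gt0 n1; rewrite -/(s n) in sn0.
have [iS S8] := moment2_partial_sum X_indep (@a_gt0 n) (@iX2 n) (@cX n) n.
have YE : (fun w => Y n w ^+ 2) =
    (fun w => (s n ^+ 2)^-1 * partial_sum X (a n) n w ^+ 2).
  by apply/funext => w; rewrite /Y normalizedE exprMn exprVn.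
have iY : Rintegrable P (fun w => Y n w ^+ 2).
  by rewrite YE; exact: RintegrableZ.
have i1 := Rintegrable_cst P 1.
split; first exact: RintegrableD.
rewrite (RintegralT_D i1 iY) Rintegral_prob_cst.
rewrite YE RintegralT_Z// -sqr_s in S8 *.
have : (s n ^+ 2)^-1 * \int[P]_w (partial_sum X (a n) n w ^+ 2) <= 8.
  by rewrite mulrC ler_pdivrMr ?exprn_gt0.
by move: (_ * _) => z; lra.
Qed.

Section lindeberg.
Hypothesis lindeberg :
  forall eps, 0 < eps -> lindeberg_sum n eps @[n --> \oo] --> 0.

Lemma max_ratio_cvg0 : max_ratio X p n @[n --> \oo] --> 0.
Proof.
apply/cvgr0Pnorm_le => e e0; pose eps := Num.sqrt (e / 2).
have e20 : 0 < e / 2 by rewrite divr_gt0.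
have eps0 : 0 < eps by rewrite sqrtr_gt0.
have /cvgr0Pnorm_le/(_ _ e20) H := lindeberg eps0.
near=> n; have n1 : (1 <= n)%N by near: n; exists 1%N.
rewrite ger0_norm ?max_ratio_ge0// (le_trans (max_ratio_le n1 eps0))//.
rewrite sqr_sqrtr ?(ltW e20)// [leRHS]splitr lerD2l.
rewrite -[leLHS]ger0_norm ?lindeberg_sum_ge0//.
by near: n.
Unshelve. all: by end_near. Qed.

Lemma cvg_cos_normalized t th :
  \int[P]_w cos (th + t * Y n w) @[n --> \oo] -->
  expR (- (t ^+ 2 / 2)) * cos th.
Proof.
apply/cvgrPdist_le => e e0; pose eps := e / (4 * (1 + `|t| ^+ 3)).
have t30 : 0 <= `|t| ^+ 3 by rewrite exprn_ge0.
have t31 : 0 < 1 + `|t| ^+ 3 by rewrite ltr_pwDl.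
have eps0 : 0 < eps by rewrite divr_gt0// mulr_gt0.
have teps : 2 * `|t| ^+ 3 * eps <= e / 2.
  have -> : 2 * `|t| ^+ 3 * eps = (e / 2) * (`|t| ^+ 3 / (1 + `|t| ^+ 3)).
    by rewrite /eps; field; rewrite gt_eqF.
  apply: ler_piMr; first by rewrite ltW// divr_gt0.
  by rewrite ler_pdivrMr// mul1r lerDr.
have : 2 * t ^+ 2 * lindeberg_sum n eps + t ^+ 4 / 4 * max_ratio X p n
    @[n --> \oo] --> 0.
  rewrite -[X in _ --> X](addr0 0) -[X in _ --> X + _](mulr0 (2 * t ^+ 2)).
  rewrite -[X in _ --> _ + X](mulr0 (t ^+ 4 / 4)).
  apply: cvgD; apply: cvgM; try exact: cvg_cst.
    exact: lindeberg.
  exact: max_ratio_cvg0.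
move=> /cvgr0Pnorm_le/(_ (e / 2)); rewrite divr_gt0// => /(_ isT) H.
near=> n; have n1 : (1 <= n)%N by near: n; exists 1%N.
rewrite distrC (le_trans (lindeberg_bound _ _ n1 eps0))// -addrA [leRHS]splitr.
rewrite lerD// (le_trans (ler_norm _))//.
by near: n.
Unshelve. all: by end_near. Qed.

Lemma cvg_normal_of_lindeberg :
  cvg_in_distribution (normalized_S' X p) (normal_prob 0 1).
Proof.
move=> f cf [M bf].
have mf : measurable_fun setT f by exact: continuous_measurable_fun.
have iN : Rintegrable (normal_prob 0 1) f.
  by apply: (@Rintegrable_bounded _ _ _ (normal_prob (0 : R) 1) f M).
rewrite -[X in _ --> X]fineK; last by apply: integrable_fin_num.
apply: cvg_EFin.
  near=> n; rewrite unlock; apply: integrable_fin_num => //.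
  apply: (@Rintegrable_bounded _ _ _ P (f \o normalized_S' X p n) M).
    exact: measurableT_comp.
  by move=> w; exact: bf.
rewrite unlock.
apply: (@cvg_Rintegral_bounded_continuous _ _ _ P Y measurable_Y
  cvg_cos_normalized 9 f M) => //.
by near=> n; apply: moment2_normalized; near: n; exists 1%N.
Unshelve. all: by end_near. Qed.

End lindeberg.

Section feller.
Hypothesis max_ratio0 : max_ratio X p n @[n --> \oo] --> 0.
Hypothesis cvgY : cvg_in_distribution (normalized_S' X p) (normal_prob 0 1).

Lemma cvg_cos_of_normal t th :
  \int[P]_w cos (th + t * Y n w) @[n --> \oo] -->
  expR (- (t ^+ 2 / 2)) * cos th.
Proof.
rewrite -Rintegral_normal_cos.
pose f x := cos (th + t * x).
have cf : continuous f.
  move=> x; apply: (@continuous_comp _ _ _ (fun x => th + t * x) cos).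
    by apply: cvgD; [exact: cvg_cst|apply: cvgM; [exact: cvg_cst|exact: cvg_id]].
  exact: continuous_cos.
have mf : measurable_fun setT f by exact: continuous_measurable_fun.
have iN : Rintegrable (normal_prob 0 1) f.
  apply: (@Rintegrable_bounded _ _ _ (normal_prob (0 : R) 1) f 1) => // x.
  exact: cos_max.
have bf : exists M : R, forall x, `|f x| <= M by exists 1 => x; exact: cos_max.
have := cvgY cf bf.
rewrite -[X in _ --> X -> _]fineK; last by apply: integrable_fin_num.
by move=> /fine_cvg; rewrite unlock.
Qed.

(** The coefficient of the Lindeberg sum is positive for large [t], while the
    right-hand side depends only on the characteristic function of the normalized
    sum and on the largest variance, and tends to 0 when these behave as in the
    limit theorem. *)
Lemma lindeberg_sum_le n eps t (r := t ^+ 2 / 2 * max_ratio X p n)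
    (Q := (\int[P]_w cos (0 + t * Y n w)) ^+ 2 +
          (\int[P]_w cos (pi / 2 + t * Y n w)) ^+ 2) :
  (1 <= n)%N -> 0 < eps -> r < 1 ->
  (t ^+ 2 / 2 - 2 / eps ^+ 2) * lindeberg_sum n eps <=
  t ^+ 2 / 2 + (1 - r) / 2 * ln Q.
Proof.
move=> n1 e0 r1; have sn0 := s'_gt0 n1; rewrite -/(s n) in sn0.
have sne : s n != 0 by rewrite gt_eqF.
have es0 : 0 < eps * s n by rewrite mulr_gt0.
pose A := \sum_(a n <= k < a n + n) (1 - mean_cos X (t / s n) k).
have AQ : - (2 * A / (1 - r)) <= ln Q.
  suff h : expR (- (2 * A / (1 - r))) <= Q.
    have Q0 : 0 < Q by apply: lt_le_trans h; exact: expR_gt0.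
    by rewrite -[leLHS]expRK ler_ln ?posrE ?expR_gt0.
  have := prod_mean_cos_le X_indep (@a_gt0 n) (t / s n) n.
  rewrite -!cos_scale; apply: le_trans.
  apply: expR_le_prod_mean_cos => // k kn; case/andP: (kn) => ak _.
  apply: (le_trans (mean_cos_ge (@iX2 n) (t / s n) ak)).
  have -> : (t / s n) ^+ 2 * moment2 X k / 2 =
      t ^+ 2 / 2 * (moment2 X k / s n ^+ 2) by field.
  by rewrite ler_wpM2l ?sigma_ratio_le// divr_ge0 ?sqr_ge0.
have AE : (t ^+ 2 / 2 - 2 / eps ^+ 2) * lindeberg_sum n eps <= t ^+ 2 / 2 - A.
  have -> : (t ^+ 2 / 2 - 2 / eps ^+ 2) * lindeberg_sum n eps =
    \sum_(a n <= k < a n + n) (((t / s n) ^+ 2 / 2 - 2 / (eps * s n) ^+ 2) *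
       tail_moment2 X (eps * s n) k).
    rewrite -mulr_sumr /lindeberg_sum; field.
    by rewrite sne gt_eqF.
  have -> : t ^+ 2 / 2 - A = \sum_(a n <= k < a n + n)
      ((t / s n) ^+ 2 * moment2 X k / 2 - (1 - mean_cos X (t / s n) k)).
    rewrite sumrB -/A -mulr_suml -mulr_sumr -sqr_s; congr (_ - _); by field.
  apply: ler_sum_nat => k /andP[ak _].
  exact: (tail_moment2_le (@iX2 n)).
apply: (le_trans AE); rewrite lerD2l.
have r10 : 0 < (1 - r) / 2 by rewrite divr_gt0// subr_gt0.
have -> : - A = (1 - r) / 2 * - (2 * A / (1 - r)).
  by field; rewrite subr_eq0 gt_eqF.
by rewrite ler_pM2l.
Qed.

Lemma lindeberg_of_cvg_normal eps : 0 < eps ->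
  lindeberg_sum n eps @[n --> \oo] --> 0.
Proof.
move=> e0.
(* This choice of [t] gives the Lindeberg sum the coefficient 1 in
   [lindeberg_sum_le]. *)
pose t := Num.sqrt (2 + 4 / eps ^+ 2).
have t2 : t ^+ 2 = 2 + 4 / eps ^+ 2.
  by rewrite sqr_sqrtr// addr_ge0// divr_ge0 ?sqr_ge0.
have coef : t ^+ 2 / 2 - 2 / eps ^+ 2 = 1.
  by rewrite t2; field; rewrite gt_eqF.
pose r n := t ^+ 2 / 2 * max_ratio X p n.
pose Q n := (\int[P]_w cos (0 + t * Y n w)) ^+ 2 +
          (\int[P]_w cos (pi / 2 + t * Y n w)) ^+ 2.
have r0 : r n @[n --> \oo] --> 0.
  rewrite -[X in _ --> X](mulr0 (t ^+ 2 / 2)).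
  by apply: cvgM; [exact: cvg_cst|exact: max_ratio0].
have Q0 : Q n @[n --> \oo] --> expR (- t ^+ 2).
  have -> : expR (- t ^+ 2) = (expR (- (t ^+ 2 / 2)) * cos 0) ^+ 2 +
      (expR (- (t ^+ 2 / 2)) * cos (pi / 2)) ^+ 2.
    rewrite cos0 cos_pihalf mulr1 mulr0 expr0n addr0 -expRM_natl.
    by congr expR; field.
  apply: cvgD; apply: (cvg_comp _ (fun x => x ^+ 2)); try exact: sqr_continuous.
    exact: cvg_cos_of_normal.
  exact: cvg_cos_of_normal.
have U0 : t ^+ 2 / 2 + (1 - r n) / 2 * ln (Q n) @[n --> \oo] --> 0.
  rewrite (_ : 0 = t ^+ 2 / 2 + (1 - 0) / 2 * ln (expR (- t ^+ 2))); last first.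
    by rewrite expRK; field.
  apply: cvgD; first exact: cvg_cst.
  apply: cvgM.
    by apply: cvgM; [apply: cvgB => //; exact: cvg_cst|exact: cvg_cst].
  by apply: (cvg_comp _ (@ln R) Q0); apply: continuous_ln; exact: expR_gt0.
apply: (@squeeze_cvgr _ _ _ _ (cst 0) _ _ _ _ _ U0); last exact: cvg_cst.
near=> n; have n1 : (1 <= n)%N by near: n; exists 1%N.
have rn1 : t ^+ 2 / 2 * max_ratio X p n < 1 by near: n; exact: (cvgr_lt 0 r0).
have := lindeberg_sum_le n1 e0 rn1; rewrite coef mul1r => h.
by rewrite lindeberg_sum_ge0; exact: h.
Unshelve. all: by end_near. Qed.

End feller.

End lindeberg_feller.

Theorem theorem2 (R : realType) (d : measure_display) (T : measurableType d)
    (P : probability T R) (X : nat -> {RV P >-> R}) (p : nat -> nat)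
    (X_indep : independent_RVs [set k | (1 <= k)%N] X)
    (X_L2 : forall k, (1 <= k)%N -> (X k : T -> R) \in Lfun P 2%:E)
    (X_centered : forall k, (1 <= k)%N -> ('E_P[X k] = 0)%E)
    (s'_gt0 : forall n, (1 <= n)%N -> 0 < s' X p n) :
  (max_ratio X p n @[n --> \oo] --> (0 : R) /\
   cvg_in_distribution (normalized_S' X p) (normal_prob 0 1))
  <->
  (forall eps : R, 0 < eps -> g X p n eps @[n --> \oo] --> 0%E).
Proof.
split=> [[ratio0 cvgY] eps e0|lindeberg].
  apply/(cvg_lindeberg_sum p X_L2).
  exact: (lindeberg_of_cvg_normal X_indep X_L2 s'_gt0).
have H eps : 0 < eps -> lindeberg_sum X p n eps @[n --> \oo] --> 0.
  by move=> e0; apply/(cvg_lindeberg_sum p X_L2); exact: lindeberg.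
split; first exact: (max_ratio_cvg0 X_L2 s'_gt0).
exact: (cvg_normal_of_lindeberg X_indep X_L2 X_centered s'_gt0).
Qed.
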